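(* For every integer $n\geq 5$, $BR(C_8,C_{2n})=n+3$.
   Context: $C_m$ denotes the cycle on $m$ vertices and $K_{b,b}$ the complete bipartite graph with both parts of size $b$. For bipartite graphs $G_1,G_2$, $BR(G_1,G_2)$ is the smallest positive integer $b$ such that for every 2-edge-coloring of $K_{b,b}$ with colors 1 and 2, there is a subgraph isomorphic to $G_1$ all of whose edges have color 1, or a subgraph isomorphic to $G_2$ all of whose edges have color 2. *)

(* Defs.v *)
From mathcomp Require Import all_boot.

Set Implicit Arguments.
Unset Strict Implicit.
Unset Printing Implicit Defensive.

Record sgraph := SGraph {
  svertex :> finType;
  sedge : rel svertex;
  sedge_sym : symmetric sedge;
  sedge_irr : irreflexive sedge }.

(* The first conjunct only matters for m = 1, where it excludes a loop. *)
Definition cycle_rel (m : nat) : rel 'I_m :=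
  fun i j => (i != j) && ((i.+1 %% m == j) || (j.+1 %% m == i)).

Lemma cycle_rel_sym m : symmetric (@cycle_rel m).
Proof. by move=> i j; rewrite /cycle_rel eq_sym orbC. Qed.

Lemma cycle_rel_irr m : irreflexive (@cycle_rel m).
Proof. by move=> i; rewrite /cycle_rel eqxx. Qed.

Definition cycle_graph (m : nat) : sgraph :=
  SGraph (@cycle_rel_sym m) (@cycle_rel_irr m).

Definition bip_rel (a b : nat) : rel ('I_a + 'I_b)%type :=
  fun u v => match u, v with
             | inl _, inr _ | inr _, inl _ => true
             | _, _ => false
             end.

Lemma bip_rel_sym a b : symmetric (@bip_rel a b).
Proof. by case=> i [] j. Qed.

Lemma bip_rel_irr a b : irreflexive (@bip_rel a b).
Proof. by case. Qed.

Definition complete_bipartite (a b : nat) : sgraph :=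
  SGraph (@bip_rel_sym a b) (@bip_rel_irr a b).

(* The edge xy is the unordered pair [set x; y].  A colouring is represented by
   a total function on sets of vertices, of which only the values on edges are
   ever used; true is colour 1 and false is colour 2. *)
Definition edge_coloring (H : sgraph) := {set H} -> bool.

(* H has a (not necessarily induced) subgraph isomorphic to G, all of whose
   edges have colour k under c. *)
Definition mono_copy (G H : sgraph) (c : edge_coloring H) (k : bool) : Prop :=
  exists f : G -> H, injective f /\
    forall x y : G, sedge x y ->
      sedge (f x) (f y) /\ c [set f x; f y] = k.

Definition bip_arrows (b : nat) (G1 G2 : sgraph) : Prop :=
  forall c : edge_coloring (complete_bipartite b b),
    mono_copy G1 c true \/ mono_copy G2 c false.

(* BR(G1, G2) = b.  Stated as a relation, so that it includes the existence of
   the minimum. *)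
Definition is_BR (G1 G2 : sgraph) (b : nat) : Prop :=
  [/\ 0 < b, bip_arrows b G1 G2 &
      forall b' : nat, 0 < b' -> bip_arrows b' G1 G2 -> b <= b'].

(* Main.v *)
Require Import Defs.
From mathcomp Require Import all_boot zify.

(** The cycle [C_(2n)] is grown inside the second colour class of [K_(b,b)],
    [b = n + 3], assuming that the first class ("red") has no [C_8].  The key
    fact concerns [K_(8,8)]: if [x_0 y_0 ... x_3 y_3] is a blue path, if 4 + 4
    vertices lie outside it and there is no red [C_8], then some blue path on
    10 vertices has the same ends [x_0] and [y_3].  Substituting it for an
    8-vertex segment lengthens every blue [C_(2k)] with [k >= 4] that misses
    4 + 4 vertices, so it suffices to find a blue [C_8] in [K_(8,8)].
    Pigeonhole gives a monochromatic [C_4]; for either colour, if the other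
    colour has no [C_8], a [C_4] missing 5 + 5 vertices yields a [C_6], and a
    [C_6] missing 5 + 5 vertices yields a [C_8].

    These three extension facts are finite.  Each is proved by evaluating a
    checker on a refutation tree.  Sorting the outside vertices by the colours
    of their edges to the given path removes most of the symmetry and keeps the
    trees small.

    For the lower bound, colour red the edges at three fixed vertices of one
    side. *)

Set Implicit Arguments.
Unset Strict Implicit.
Unset Printing Implicit Defensive.

(** The last growth step fixes the bound n + 3: a cycle with n - 1 pairs leaves exactly 4 + 4
    vertices outside it. Keeping both ends of the segment confines the change to 8 + 8 vertices,
    however long the cycle is, so that one finite fact serves all n. The two starting facts
    rearrange the whole cycle instead, since a cycle on 4 or 6 vertices contains no such segment.

    K_(8,8) has 352800 cycles on 8 vertices, too many to write one clause against each red one. Only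
    the clauses against blue targets and the ordering clauses are explicit; the absence of a red C_8
    is used on demand, for one named edge at a time, and a search confirms that this edge would
    close such a cycle.

    The outside vertices of both sides can be sorted simultaneously because they are compared only
    through their edges to the given path: permuting the outside vertices of one side does not
    affect the comparisons on the other. *)

Section AlternatingCycles.

Variables X Y : eqType.

(* A list [(x_0, y_0), (x_1, y_1), ...] stands for the path, or the cycle,
   [x_0 y_0 x_1 y_1 ...]. *)
Definition alt (e : X -> Y -> bool) : rel (X * Y) :=
  fun u v => e u.1 u.2 && e v.1 u.2.

Definition alt_cycle (e : X -> Y -> bool) (q : seq (X * Y)) :=
  [&& uniq (unzip1 q), uniq (unzip2 q) & cycle (alt e) q].

(** The parameter counts pairs, so [k] stands for a cycle on [2 * k] vertices; the forbidden red C_8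
    is the case [k = 4]. *)
Definition has_alt_cycle (e : X -> Y -> bool) (k : nat) :=
  exists2 q, size q = k & alt_cycle e q.

End AlternatingCycles.

(** * The refutation checker *)

Notation edge := (nat * nat)%type.
Notation literal := (edge * bool)%type.

(* A partial colouring: row [i], column [j] is the colour of the edge
   [x_i y_j], with [Some true] for red, [Some false] for blue and [None] for
   undecided. *)
Notation state := (seq (seq (option bool))).

Definition value (s : state) (e : edge) := nth None (nth [::] s e.1) e.2.

Definition assign (s : state) (e : edge) (b : bool) : state :=
  set_nth [::] s e.1 (set_nth None (nth [::] s e.1) e.2 (Some b)).

Variant outcome := Conflict | Idle | Implied of edge & bool.

(** A clause is the disjunction of its literals, and [(e, b)] states that [e] has colour [b]. The
    accumulator [o] summarises the literals read so far, none of which is true: [Conflict] if all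
    are false, [Implied] if exactly one is undecided. A true literal or a second undecided one makes
    the clause [Idle]. *)
Fixpoint scan (s : state) (c : seq literal) (o : outcome) : outcome :=
  if c is (e, b) :: c' then
    match value s e with
    | Some b' => if b' (+) b then scan s c' o else Idle
    | None => if o is Conflict then scan s c' (Implied e b) else Idle
    end
  else o.

Fixpoint unit_pass (s : state) (cs : seq (seq literal)) : option state :=
  if cs is c :: cs' then
    match scan s c Conflict with
    | Conflict => None
    | Idle => unit_pass s cs'
    | Implied e b => unit_pass (assign s e b) cs'
    end
  else Some s.

Definition is_red (s : state) (i j : nat) :=
  if value s (i, j) is Some true then true else false.

(** Non-membership on plain natural numbers, because the search in [closes] evaluates it at every
    node. *)
Fixpoint outside (i : nat) (l : seq nat) :=
  if l is j :: l' then ~~ eqn i j && outside i l' else true.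

(* Is there a red path [x y1 x1 y2 x2 y3 x3 y]?  The search runs from both ends. *)
Definition closes (n : nat) (s : state) (x y : nat) :=
  let rows := [seq [seq j <- iota 0 n | is_red s i j] | i <- iota 0 n] in
  let cols := [seq [seq i <- iota 0 n | is_red s i j] | j <- iota 0 n] in
  has (fun x3 => outside x3 [:: x] &&
  has (fun y1 => outside y1 [:: y] &&
  has (fun y3 => outside y3 [:: y; y1] &&
  has (fun x1 => outside x1 [:: x; x3] &&
  has (fun x2 => outside x2 [:: x; x3; x1] &&
  has (fun y2 => outside y2 [:: y; y1; y3] && is_red s x1 y2)
    (nth [::] rows x2))
    (nth [::] cols y3))
    (nth [::] cols y1))
    (nth [::] rows x3))
    (nth [::] rows x))
    (nth [::] cols y).

(* [B i j] branches on the edge [x_i y_j]; [F i j] colours it blue because red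
   would close a red [C_8]; [U] performs one pass of unit propagation.  A
   refutation is a list of such tokens acting on a stack of partial colourings:
   it works on the top one, which is popped when it turns out contradictory. *)
Variant token := B of nat & nat | F of nat & nat | U.

Fixpoint refutes (n : nat) (cs : seq (seq literal)) (ts : seq token)
    (stack : seq state) : bool :=
  match ts, stack with
  | [::], [::] => true
  | B i j :: ts', s :: stack' =>
      refutes n cs ts' (assign s (i, j) false :: assign s (i, j) true :: stack')
  | F i j :: ts', s :: stack' => closes n s i j &&
      refutes n cs ts'
        (if is_red s i j then stack' else assign s (i, j) false :: stack')
  | U :: ts', s :: stack' =>
      refutes n cs ts'
        (if unit_pass s cs is Some s' then s' :: stack' else stack')
  | _, _ => false
  end.

Fixpoint path_edges (u : edge) (q : seq edge) : seq edge :=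
  if q is v :: q' then u :: (v.1, u.2) :: path_edges v q' else [:: u].

Definition edges_of (closed : bool) (q : seq edge) : seq edge :=
  if q is u :: q' then
    if closed then (u.1, (last u q').2) :: path_edges u q' else path_edges u q'
  else [::].

Definition base_path (m : nat) := [seq (i, i) | i <- iota 0 m].

Definition start (m n : nat) (closed : bool) : state :=
  foldr (fun e s => assign s e false) (nseq n (nseq n None))
    (edges_of closed (base_path m)).

(** Expresses that the target [q] is not entirely blue. Edges shared with the base path are dropped,
    being blue from the start. *)
Definition path_clause (m : nat) (closed : bool) (q : seq edge) : seq literal :=
  [seq (e, true) | e <- edges_of closed q & e \notin edges_of closed (base_path m)].

(* Clauses saying that the colours of the edges in the first components precede
   lexicographically those in the second components. *)
Fixpoint lex_clauses (l : seq (edge * edge)) : seq (seq literal) :=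
  if l is (e, f) :: l' then
    [:: (e, false); (f, true)]
    :: flatten [seq [:: [:: (e, true), (f, true) & c];
                        [:: (e, false), (f, false) & c]]
               | c <- lex_clauses l']
  else [::].

Definition order_clauses (m r : nat) : seq (seq literal) :=
  flatten [seq lex_clauses [seq ((m + i, j), (m + i.+1, j)) | j <- iota 0 m]
          | i <- iota 0 r.-1]
  ++ flatten [seq lex_clauses [seq ((j, m + i), (j, m + i.+1)) | j <- iota 0 m]
             | i <- iota 0 r.-1].

Definition clauses m r closed qs :=
  map (path_clause m closed) qs ++ order_clauses m r.

(** * Soundness *)

(** Bounds matter for cycles and targets, whose indices are later turned into vertices. Colours are
    read on all pairs of naturals, so the indices in a token can be arbitrary. *)
Definition within (n : nat) (q : seq edge) :=
  all (fun u => (u.1 < n) && (u.2 < n)) q.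

Section Refutation.

Variables (col : nat -> nat -> bool) (n : nat) (cs : seq (seq literal)).

Definition agrees (s : state) :=
  forall e b, value s e = Some b -> col e.1 e.2 = b.

Definition holds (l : literal) := col l.1.1 l.1.2 == l.2.

Lemma value_assign s e b f :
  value (assign s e b) f = if f == e then Some b else value s f.
Proof.
case: e f => [i j] [k l]; rewrite /value /assign /= nth_set_nth /= xpair_eqE.
by case: (k =P i) => // ->; rewrite nth_set_nth /=.
Qed.

Lemma agrees_assign s e : agrees s -> agrees (assign s e (col e.1 e.2)).
Proof.
by move=> ag f b; rewrite value_assign; case: (f =P e) => [-> [] | _ /ag].
Qed.

(** The hypothesis is the loop invariant: a true literal is still to be read, or it is the pending
    one recorded in [o], or [o] claims nothing. *)
Lemma scan_sound s c o : agrees s ->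
  has holds c || match o with
                 | Conflict => false
                 | Idle => true
                 | Implied e b => holds (e, b)
                 end ->
  match scan s c o with
  | Conflict => False
  | Idle => True
  | Implied e b => holds (e, b)
  end.
Proof.
move=> ag; elim: c o => [|[e b] c IH] o /=; first by case: o.
case v: (value s e) => [b'|]; last first.
  case: o => //= h; apply: IH; move: h; rewrite orbF.
  by case/orP=> ->; rewrite ?orbT.
case: ifP => // bb' h; apply: IH; move: h.
by rewrite /holds /= (ag _ _ v); case: (b') (b) bb' => [] [].
Qed.

Hypothesis cs_hold : all (has holds) cs.

Lemma unit_pass_sound s :
  agrees s -> if unit_pass s cs is Some s' then agrees s' else False.
Proof.
elim: cs s cs_hold => //= c cs' IH s /andP[hc hcs] ag.
have := @scan_sound s c Conflict ag; rewrite hc => /(_ isT).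
case: (scan s c Conflict) => // [_|e b /eqP/= <-]; first exact: IH.
by apply: IH => //; apply: agrees_assign.
Qed.

Hypothesis no_red_C8 : forall q, size q = 4 -> within n q -> ~~ alt_cycle col q.

Lemma is_redP s i j : agrees s -> is_red s i j -> col i j.
Proof.
move=> ag; rewrite /is_red; case v: (value s (i, j)) => [[]|] // _.
exact: (ag _ _ v).
Qed.

Lemma outsideP i l : outside i l = (i \notin l).
Proof. by elim: l => //= j l ->; rewrite inE negb_or. Qed.

Lemma closes_sound s x y : agrees s -> closes n s x y -> col x y = false.
Proof.
move=> ag; rewrite /closes.
set rows := map _ _; set cols := map _ _.
(* An index out of range selects the empty default list, so membership also yields the bounds that
   [no_red_C8] asks for. *)
have rowP i j : j \in nth [::] rows i -> [/\ i < n, j < n & col i j].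
  case: (ltnP i n) => lt_in; last by rewrite nth_default // size_map size_iota.
  rewrite (nth_map 0) ?size_iota // nth_iota // mem_filter mem_iota /= add0n.
  by case/andP=> /(is_redP ag).
have colP i j : i \in nth [::] cols j -> [/\ i < n, j < n & col i j].
  case: (ltnP j n) => lt_jn; last by rewrite nth_default // size_map size_iota.
  rewrite (nth_map 0) ?size_iota // nth_iota // mem_filter mem_iota /= add0n.
  by case/andP=> /(is_redP ag).
case/hasP=> x3 /colP[x3n yn r3y] /andP[o3].
case/hasP=> y1 /rowP[xn y1n r1] /andP[o1].
case/hasP=> y3 /rowP[_ y3n r33] /andP[oy3].
case/hasP=> x1 /colP[x1n _ r11] /andP[ox1].
case/hasP=> x2 /colP[x2n _ r23] /andP[ox2].
case/hasP=> y2 /rowP[_ y2n r22] /andP[oy2 /(is_redP ag) r12].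
case rxy: (col x y) => //.
(* If the edge from [x] to [y] were red, these four pairs would list the red cycle x y1 x1 y2 x2 y3
   x3 y. *)
have := no_red_C8 (q := [:: (x, y1); (x1, y2); (x2, y3); (x3, y)]) erefl.
rewrite /within /alt_cycle /alt /= xn x1n x2n x3n yn y1n y2n y3n.
rewrite r1 r11 r12 r22 r23 r33 r3y rxy /= !andbT => /(_ isT).
move: o3 o1 oy3 ox1 ox2 oy2; rewrite !outsideP !inE !negb_or.
rewrite (eq_sym x1 x) (eq_sym x2 x) (eq_sym x3 x) (eq_sym x2 x1).
rewrite (eq_sym y2 y1) (eq_sym y3 y1).
move=> -> /negbTE oy1 /andP[/negbTE oy3 ->] /andP[-> /negbTE ox1].
case/and3P=> -> /negbTE ox2 -> /and3P[/negbTE oy2 -> ->].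
by rewrite ox1 ox2 oy1 oy2 oy3.
Qed.

(** Every token turns a stack containing a state that agrees with [col] into another such stack, and
    a refutation ends with the empty stack. *)
Lemma refutes_sound ts stack :
  refutes n cs ts stack -> ~ exists2 s, s \in stack & agrees s.
Proof.
elim: ts stack => [|t ts IH] [|s st] //=; first by move=> _ [].
  by case: t.
case: t => [i j|i j|]; last first.
- move/IH=> h [s' ss' ag]; apply: h.
  move: ss' ag; rewrite in_cons => /predU1P[-> ag|s'st ag]; last first.
    case: (unit_pass s cs) => [s''|]; exists s' => //.
    by rewrite inE s'st orbT.
  have := unit_pass_sound ag; case: (unit_pass s cs) => // s'' ag'.
  by exists s''; rewrite ?inE ?eqxx.
- case/andP=> cl /IH h [s' ss' ag]; apply: h.
  move: ss' ag; rewrite in_cons => /predU1P[-> ag|s'st ag]; last first.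
    by case: ifP => _; exists s'; rewrite // inE s'st orbT.
  have cij := closes_sound ag cl.
  (* If the state already has this edge red, it cannot agree with [col], so popping it loses
     nothing. *)
  case: ifP => [/(is_redP ag)|_]; first by rewrite cij.
  exists (assign s (i, j) false); rewrite ?inE ?eqxx //.
  by rewrite -[false]cij; apply: (agrees_assign (e := (i, j))).
- move/IH=> h [s' ss' ag]; apply: h.
  move: ss' ag; rewrite in_cons => /predU1P[-> ag|s'st ag]; last first.
    by exists s'; rewrite // !inE s'st !orbT.
  (* Of the two branches, the one carrying the actual colour of the edge still agrees. *)
  exists (assign s (i, j) (col i j)); last exact: (agrees_assign (e := (i, j))).
  by case: (col i j); rewrite !inE eqxx ?orbT.
Qed.

End Refutation.

(** * Validity of a certified extension *)

Fixpoint lexb (s t : seq bool) : bool :=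
  match s, t with
  | a :: s', b :: t' => if a (+) b then b else lexb s' t'
  | _, _ => true
  end.

Lemma lexb_total : total lexb.
Proof. by elim=> [|a s IH] [|b t] //=; case: a b => [] [] //=; apply: IH. Qed.

Lemma all_flatten (T : Type) (p : pred T) (ss : seq (seq T)) :
  all p (flatten ss) = all (all p) ss.
Proof. by elim: ss => //= s ss <-; rewrite all_cat. Qed.

(** If the first two colours differ, each guarded copy of the remaining clauses is satisfied by its
    guard; if they agree, the comparison of the tails provides the remaining clauses. *)
Lemma lex_clauses_hold col (l : seq (edge * edge)) :
  lexb [seq col p.1.1 p.1.2 | p <- l] [seq col p.2.1 p.2.2 | p <- l] ->
  all (has (holds col)) (lex_clauses l).
Proof.
elim: l => [|[e f] l IH] //= h; apply/andP; split.
  by rewrite /holds /=; case: (col e.1 e.2) (col f.1 f.2) h => [] [].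
rewrite all_flatten all_map; apply/allP => c cl /=; rewrite /holds /=.
case: (col e.1 e.2) (col f.1 f.2) h => [] [] //= /IH/allP/(_ c cl) ->.
all: by rewrite ?orbT.
Qed.

(** A step of [alt] covers the edge inside its first pair and the edge to the next pair. The edge
    inside the last pair is therefore not covered by any step and is added separately. *)
Lemma path_edgesE (c : nat -> nat -> bool) u q :
  all (fun e => c e.1 e.2) (path_edges u q) =
  path (alt c) u q && c (last u q).1 (last u q).2.
Proof. by elim: q u => [|v q IH] u /=; rewrite ?andbT // IH /alt !andbA. Qed.

(** An open target has the same two end vertices as the base path, so that it can take its place
    inside a longer cycle; a closed target replaces the whole cycle and may use any vertices. *)
Definition good (m n : nat) (closed : bool) (q : seq edge) :=
  [&& size q == m.+1, uniq (unzip1 q), uniq (unzip2 q), within n q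
    & closed || ((head (0, 0) q).1 == 0) && ((last (0, 0) q).2 == m.-1)].

(** The origin of the data is irrelevant: each target is validated by [good], and the list [qs] may
    be incomplete, since leaving out a target only removes a clause available to the refutation. *)
Definition certified (m r : nat) (closed : bool) (qs : seq (seq edge))
    (ts : seq token) :=
  all (good m (m + r) closed) qs &&
  refutes (m + r) (clauses m r closed qs) ts [:: start m (m + r) closed].

Lemma agrees_start col m n closed :
  all (fun e => ~~ col e.1 e.2) (edges_of closed (base_path m)) ->
  agrees col (start m n closed).
Proof.
rewrite /start; elim: (edges_of _ _) => [_ e b|e l IH /= /andP[/negbTE be /IH ag]].
  by rewrite /value /= nth_nseq; case: ifP; rewrite /= ?nth_nseq ?if_same ?nth_nil.
by have := agrees_assign (e := e) ag; rewrite be.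
Qed.

(** If every listed target had a red edge, [col] would satisfy all the clauses and agree with the
    starting state, which the refutation excludes. *)
Lemma certified_sound col m r closed qs ts :
  certified m r closed qs ts ->
  all (fun e => ~~ col e.1 e.2) (edges_of closed (base_path m)) ->
  (forall i, i.+1 < r -> lexb [seq col (m + i) j | j <- iota 0 m]
                              [seq col (m + i.+1) j | j <- iota 0 m]) ->
  (forall i, i.+1 < r -> lexb [seq col j (m + i) | j <- iota 0 m]
                              [seq col j (m + i.+1) | j <- iota 0 m]) ->
  (forall q, size q = 4 -> within (m + r) q -> ~~ alt_cycle col q) ->
  exists2 q, good m (m + r) closed q
    & all (fun e => ~~ col e.1 e.2) (edges_of closed q).
Proof.
case/andP=> /allP good_qs ref blue_base lexX lexY no_C8.
have [/hasP[q qqs blue_q]|no_q] :=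
  boolP (has (fun q => all (fun e => ~~ col e.1 e.2) (edges_of closed q)) qs).
  by exists q => //; apply: good_qs.
case: (refutes_sound _ no_C8 ref); last first.
  exists (start m (m + r) closed); first by rewrite inE.
  exact: agrees_start.
rewrite /clauses /order_clauses !all_cat; apply/and3P; split.
- rewrite all_map; apply/allP=> q qqs /=.
  (* The red edge is not on the base path, which is blue, so it survives the filter in
     [path_clause]. *)
  have /allPn[e eq /negPn ce] := hasPn no_q _ qqs.
  apply/hasP; exists (e, true); last by rewrite /holds /= ce.
  apply: map_f; rewrite mem_filter eq andbT.
  by apply: contraL ce; apply: (allP blue_base).
- rewrite all_flatten all_map; apply/allP=> i; rewrite mem_iota add0n /= => ir.
  apply: lex_clauses_hold; rewrite -!map_comp; apply: lexX.
  by case: (r) ir.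
- rewrite all_flatten all_map; apply/allP=> i; rewrite mem_iota add0n /= => ir.
  apply: lex_clauses_hold; rewrite -!map_comp; apply: lexY.
  by case: (r) ir.
Qed.

(** * Replacing a segment of a cycle by a certified path *)

Lemma sorted_completion (T : finType) (le : rel T) (l : seq T) r :
  total le -> uniq l -> size l + r <= #|T| ->
  exists o, [/\ size o = r, uniq (l ++ o) & sorted le o].
Proof.
move=> le_tot ul szl.
pose o := sort le (take r [seq x <- enum T | x \notin l]).
exists o; split; last exact: sort_sorted.
  rewrite size_sort size_takel // size_filter.
  have := count_predC (mem l) (enum T); rewrite -cardE.
  have -> : count (mem l) (enum T) = size l.
    by rewrite -(card_uniqP ul) -size_filter cardE enumT. 
  by move=> E; rewrite -(leq_add2l (size l)) E.
rewrite cat_uniq ul /=; apply/andP; split; last first.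
  by rewrite sort_uniq; rewrite take_uniq // filter_uniq // enum_uniq.
apply/hasPn=> x; rewrite mem_sort => /mem_take; rewrite mem_filter.
by case/andP.
Qed.

(** On leaving [z] the path uses the edge inside [z] and the vertex [z.2]; it enters [w] at [w.1]
    and stops there. Hence the first pair may change its first component, given the new inner edge,
    and the last pair its second. *)
Lemma path_alt_ends (X Y : eqType) (e : X -> Y -> bool) z w z' w' b :
  path (alt e) z (rcons b w) -> z'.2 = z.2 -> e z'.1 z'.2 -> w'.1 = w.1 ->
  path (alt e) z' (rcons b w').
Proof.
rewrite !rcons_path => /andP[pb aw] zz ez ww.
case: b pb aw => [_|v b] /=; rewrite /alt ww; first by rewrite ez zz => /andP[].
by rewrite ez zz => /andP[/andP[_ ->] ->].
Qed.

(* [closed] selects between extending a whole cycle and replacing a segment of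
   it: in the second case the ends of the segment are kept. *)
Lemma longer_alt_cycle (X Y : finType) (red : X -> Y -> bool) m r closed qs ts s :
  0 < m -> certified m r closed qs ts ->
  alt_cycle (fun x y => ~~ red x y) s ->
  m <= size s -> (closed -> size s = m) ->
  size s + r <= #|X| -> size s + r <= #|Y| ->
  ~ has_alt_cycle red 4 ->
  has_alt_cycle (fun x y => ~~ red x y) (size s).+1.
Proof.
set blue := fun x y => _.
move=> m_gt0 cert /and3P[u1 u2 cyc] le_ms closedP leX leY no_C8.
pose a := take m s; pose b := drop m s.
have sE : s = a ++ b by rewrite cat_take_drop.
have sza : size a = m by rewrite size_takel.
have [x0 y0] : X * Y by case: (a) sza m_gt0 => [<-|p].
(* Outside vertices are compared through the segment [a] only, which is all that the certificate
   sees of the cycle. *)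
pose leX' x x' := lexb [seq red x y | y <- unzip2 a] [seq red x' y | y <- unzip2 a].
pose leY' y y' := lexb [seq red x y | x <- unzip1 a] [seq red x y' | x <- unzip1 a].
have totX : total leX' by move=> x x'; apply: lexb_total.
have totY : total leY' by move=> y y'; apply: lexb_total.
rewrite -(size_map fst s) in leX; rewrite -(size_map snd s) in leY.
(* The added vertices avoid all of [s], hence also the part [b] that is kept. *)
have [ox [szox uxo sox]] := sorted_completion totX u1 leX.
have [oy [szoy uyo soy]] := sorted_completion totY u2 leY.
pose xs := unzip1 a ++ ox; pose ys := unzip2 a ++ oy.
pose fx := nth x0 xs; pose fy := nth y0 ys.
pose g (u : edge) := (fx u.1, fy u.2).
pose col i j := red (fx i) (fy j).
have szxs : size xs = m + r by rewrite size_cat size_map sza szox.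
have szys : size ys = m + r by rewrite size_cat size_map sza szoy.
have split_uniq (T : eqType) (c d o : seq T) : uniq ((c ++ d) ++ o) ->
    uniq (c ++ o) /\ {in c ++ o, forall x, x \notin d}.
  by rewrite -catA uniq_catCA cat_uniq => /and3P[_ /hasPn].
have [uxs dxs] : uniq xs /\ {in xs, forall x, x \notin unzip1 b}.
  by apply: split_uniq; rewrite -map_cat -sE.
have [uys dys] : uniq ys /\ {in ys, forall y, y \notin unzip2 b}.
  by apply: split_uniq; rewrite -map_cat -sE.
have gP q : within (m + r) q ->
  [/\ uniq (unzip1 q) -> uniq (unzip1 (map g q)),
      uniq (unzip2 q) -> uniq (unzip2 (map g q)),
      {subset unzip1 (map g q) <= xs} & {subset unzip2 (map g q) <= ys}].
  move=> /allP wq; rewrite /unzip1 /unzip2 -!map_comp.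
  have -> : map (fst \o g) q = map fx (unzip1 q) by rewrite -map_comp.
  have -> : map (snd \o g) q = map fy (unzip2 q) by rewrite -map_comp.
  have w1 : {in unzip1 q, forall i, i < size xs}.
    by move=> _ /mapP[u /wq/andP[u1n _] ->]; rewrite szxs.
  have w2 : {in unzip2 q, forall i, i < size ys}.
    by move=> _ /mapP[u /wq/andP[_ u2n] ->]; rewrite szys.
  split.
  - rewrite (map_inj_in_uniq (f := fx)) // => i j /w1 i_lt /w1 j_lt /eqP.
    by rewrite nth_uniq // => /eqP.
  - rewrite (map_inj_in_uniq (f := fy)) // => i j /w2 i_lt /w2 j_lt /eqP.
    by rewrite nth_uniq // => /eqP.
  - by move=> _ /mapP[i /w1 i_lt ->]; apply: mem_nth.
  - by move=> _ /mapP[i /w2 i_lt ->]; apply: mem_nth.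
have fxa i : i < m -> fx i = (nth (x0, y0) a i).1.
  by move=> im; rewrite /fx nth_cat size_map sza im (nth_map (x0, y0)) ?sza.
have fya i : i < m -> fy i = (nth (x0, y0) a i).2.
  by move=> im; rewrite /fy nth_cat size_map sza im (nth_map (x0, y0)) ?sza.
have ga : map g (base_path m) = a.
  apply: (@eq_from_nth _ (x0, y0)); rewrite !size_map size_iota // => i im.
  rewrite (nth_map (0, 0)) ?size_map ?size_iota // (nth_map 0) ?size_iota //.
  by rewrite nth_iota // add0n /g fxa // fya // -surjective_pairing.
have colX i : [seq col (m + i) j | j <- iota 0 m] =
    [seq red (nth x0 ox i) y | y <- unzip2 a].
  have -> : unzip2 a = map fy (iota 0 m).
    by rewrite map_nth_iota0 ?szys ?leq_addr // take_size_cat // size_map.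
  by rewrite -map_comp /col /fx nth_cat size_map sza ltnNge leq_addr addKn.
have colY i : [seq col j (m + i) | j <- iota 0 m] =
    [seq red x (nth y0 oy i) | x <- unzip1 a].
  have -> : unzip1 a = map fx (iota 0 m).
    by rewrite map_nth_iota0 ?szxs ?leq_addr // take_size_cat // size_map.
  by rewrite -map_comp /col /fy nth_cat size_map sza ltnNge leq_addr addKn.
have [t bE tl] : exists2 t, base_path m = (0, 0) :: t & last (0, 0) t = (m.-1, m.-1).
  case: (m) m_gt0 => // k _; exists [seq (i, i) | i <- iota 1 k] => //.
  rewrite (last_map (fun i => (i, i)) _ 0) -[last 0 _]/(last 0 (iota 0 k.+1)).
  by rewrite -nth_last size_iota nth_iota.
have blueE u p : all (fun e => ~~ col e.1 e.2) (path_edges u p) =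
    path (alt blue) (g u) (map g p) && blue (fx (last u p).1) (fy (last u p).2).
  by rewrite path_map; apply: (path_edgesE (fun i j => ~~ col i j)).
have closedb : closed -> b = [::].
  by move/closedP=> szs; apply: drop_oversize; rewrite szs.
have [pt pb] : path (alt blue) (g (0, 0)) (map g t) /\
    path (alt blue) (g (m.-1, m.-1)) (rcons b (g (0, 0))).
  move: cyc; rewrite sE -ga bE /= rcons_cat cat_path last_map tl.
  by case/andP.
have [q gq bq] : exists2 q, good m (m + r) closed q
    & all (fun e => ~~ col e.1 e.2) (edges_of closed q).
  apply: (certified_sound cert).
  (* The edge inside the last pair is missing from [pt]; it is the first edge of [pb], on the way
     through [b] back to the start. *)
  - have pe : all (fun e => ~~ col e.1 e.2) (path_edges (0, 0) t).
      rewrite blueE pt tl /=.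
      by case: (b) pb => [|v b'] /= /andP[/andP[]].
    (* When [b] is empty, [pb] is a single step and its second edge closes the cycle. *)
    rewrite bE /=; case: ifP => //= /closedb b0; rewrite pe tl andbT.
    by move: pb; rewrite b0 /= andbT => /andP[].
  - by move=> i ir; rewrite !colX; apply: (sortedP x0 sox); rewrite szox.
  - by move=> i ir; rewrite !colY; apply: (sortedP y0 soy); rewrite szoy.
  - move=> p szp wp; apply: contra_notN no_C8 => /and3P[p1 p2 cp].
    have [gp1 gp2 _ _] := gP _ wp.
    exists (map g p); first by rewrite size_map.
    by rewrite /alt_cycle gp1 // gp2 // cycle_map.
have /and5P[/eqP szq q1 q2 wq ends] := gq.
have [gq1 gq2 sub1 sub2] := gP _ wq.
exists (map g q ++ b).
  by rewrite size_cat size_map szq size_drop addSn subnKC.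
have disj (T : eqType) (c d e : seq T) : uniq c -> uniq d ->
    {subset c <= e} -> {in e, forall x, x \notin d} -> uniq (c ++ d).
  move=> uc ud ce ed; rewrite uniq_catC cat_uniq uc ud andbT /=.
  by apply/hasPn=> x /ce/ed.
rewrite /alt_cycle /unzip1 /unzip2 !map_cat; apply/and3P; split.
- apply: disj (gq1 q1) _ sub1 dxs.
  by move: u1; rewrite sE /unzip1 map_cat cat_uniq => /and3P[].
- apply: disj (gq2 q2) _ sub2 dys.
  by move: u2; rewrite sE /unzip2 map_cat cat_uniq => /and3P[].
case: q szq ends bq {gq q1 q2 wq gq1 gq2 sub1 sub2} => // u q _ /= ends bq.
have [pq lq cq] : [/\ path (alt blue) (g u) (map g q),
    blue (fx (last u q).1) (fy (last u q).2)
  & closed -> blue (fx u.1) (fy (last u q).2)].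
  move: bq; case: ifP => _ /=; rewrite blueE; first by case/and3P.
  by case/andP.
rewrite rcons_cat cat_path pq last_map /=.
(* A closed target brings its own closing edge, [b] being empty. An open one shares its first and
   last vertices with [a], so the old return path through [b] still fits. *)
case/orP: ends => [cl|/andP[/eqP u0 /eqP lm]].
  by rewrite closedb //= /alt /= lq cq.
by apply: path_alt_ends pb _ _ _ => //=; rewrite ?lm ?u0.
Qed.

(** * Cycles in two-coloured complete bipartite graphs *)

Lemma eq_has_alt_cycle (X Y : eqType) (e e' : X -> Y -> bool) k :
  e =2 e' -> has_alt_cycle e k -> has_alt_cycle e' k.
Proof.
move=> ee [q szq /and3P[u1 u2 cq]]; exists q => //; apply/and3P; split=> //.
by rewrite -(eq_cycle (e := alt e)) // => u v; rewrite /alt !ee.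
Qed.

Lemma alt_cycle2 (X Y : finType) (e : X -> Y -> bool) x x' :
  x != x' -> 1 < #|[set y | e x y & e x' y]| -> has_alt_cycle e 2.
Proof.
move=> xx /card_gt1P[y [y' []]]; rewrite !inE => /andP[xy x'y] /andP[xy' x'y'] yy.
exists [:: (x, y); (x', y')] => //.
by rewrite /alt_cycle /alt /= !inE xx yy xy x'y x'y' xy'.
Qed.

(** Among 7 columns [x0] has a colour [k] on at least 4. If neither [x1] nor [x2] repeats this
    colour on two of them, at least 4 - 1 - 1 = 2 of these columns carry the other colour at both
    [x1] and [x2]. *)
Lemma mono_alt_cycle2 (X Y : finType) (e : X -> Y -> bool) :
  2 < #|X| -> 6 < #|Y| -> exists k, has_alt_cycle (fun x y => e x y == k) 2.
Proof.
case/card_gt2P=> x0 [x1 [x2 [_ [n01 n12 n20]]]] cY.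
pose A k := [set y | e x0 y == k].
have [k cA] : exists k, 3 < #|A k|.
  have : #|A true| + #|A false| = #|Y|.
    rewrite -(cardsC (A true)); congr (_ + _); apply: eq_card => y.
    by rewrite !inE; case: (e x0 y).
  case: (ltnP 3 #|A true|) => [h _|]; first by exists true.
  by exists false; lia.
pose B x := [set y | (e x0 y == k) && (e x y == k)].
case: (ltnP 1 #|B x1|) => [c1|c1]; first by exists k; apply: alt_cycle2 c1.
case: (ltnP 1 #|B x2|) => [c2|c2].
  by exists k; apply: alt_cycle2 c2; rewrite eq_sym.
exists (~~ k); apply: (@alt_cycle2 _ _ _ x1 x2) => //.
have sub : A k \subset B x1 :|: B x2
    :|: [set y | (e x1 y == ~~ k) && (e x2 y == ~~ k)].
  apply/subsetP=> y; rewrite !inE => ->.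
  by case: (e x1 y) (e x2 y) (k) => [] [] [].
have := subset_leq_card sub; rewrite !cardsU => cS.
by apply: leq_trans (_ : #|A k| - #|B x1| - #|B x2| <= _); lia.
Qed.

(** Position 2t of the cycle graph will stand for the first vertex of pair t, and position 2t + 1
    for the second. The successor of an odd position lies in the next pair, with the wrap-around
    modulo [2 * m] turning into one modulo [m]. *)
Lemma odd_next m i : i < 2 * m -> odd i ->
  odd (i.+1 %% (2 * m)) = false /\ (i.+1 %% (2 * m))./2 = i./2.+1 %% m.
Proof.
move=> i_lt oi; have [i1|i1] := ltnP i.+1 (2 * m).
  have h1 : i./2.+1 < m by lia.
  by rewrite !modn_small //; lia.
have -> : i.+1 = 2 * m by lia.
have -> : i./2.+1 = m by lia.
by rewrite !modnn.
Qed.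

Lemma even_next m i : i < 2 * m -> ~~ odd i ->
  odd (i.+1 %% (2 * m)) /\ (i.+1 %% (2 * m))./2 = i./2.
Proof. by move=> i_lt oi; rewrite modn_small; lia. Qed.

(** * Alternating cycles and copies of cycle graphs *)

Section Colouring.

Variables (b : nat) (c : edge_coloring (complete_bipartite b b)).

Definition coloured (k : bool) (i j : 'I_b) := c [set inl i; inr j] == k.

Lemma mono_copy_of_alt_cycle k m :
  1 < m -> has_alt_cycle (coloured k) m -> mono_copy (cycle_graph (2 * m)) c k.
Proof.
move=> m_gt1 [q szq /and3P[u1 u2 cyc]].
have [p0 q'] : 'I_b * 'I_b by case: (q) szq m_gt1 => [<-|p].
pose d : 'I_b * 'I_b := (p0, q').
have nxt t : t < m -> alt (coloured k) (nth d q t) (nth d q (t.+1 %% m)).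
  move=> tm; case: q szq cyc {u1 u2} => [|u q1] /= szq; first by lia.
  move/(pathP d)/(_ t); rewrite size_rcons szq -rcons_cons nth_rcons /= szq tm.
  move=> /(_ isT); rewrite nth_rcons.
  have [t1|t1] := ltnP t (size q1).
    have t1m : t.+1 < m by rewrite -szq.
    by rewrite modn_small.
  have -> : t = size q1 by apply/eqP; rewrite eqn_leq t1 -ltnS szq tm.
  by rewrite eqxx szq modnn.
pose f (i : cycle_graph (2 * m)) : complete_bipartite b b :=
  if odd (val i) then inr (nth d q (val i)./2).2 else inl (nth d q (val i)./2).1.
have half_lt (i : 'I_(2 * m)) : i./2 < m.
  by have := ltn_ord i; lia.
exists f; split.
  move=> i j; rewrite /f.
  have hi := half_lt i; have hj := half_lt j.
  have nth1 t t' : t < m -> t' < m -> (nth d q t).1 = (nth d q t').1 -> t = t'.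
    move=> tm t'm /eqP; rewrite -!(nth_map d p0 fst) ?szq //.
    by rewrite nth_uniq ?size_map ?szq // => /eqP.
  have nth2 t t' : t < m -> t' < m -> (nth d q t).2 = (nth d q t').2 -> t = t'.
    move=> tm t'm /eqP; rewrite -!(nth_map d p0 snd) ?szq //.
    by rewrite nth_uniq ?size_map ?szq // => /eqP.
  case oi: (odd _); case oj: (odd _) => // -[].
    move/(nth2 _ _ hi hj) => ij; apply: val_inj.
    by rewrite /= -(odd_double_half i) -(odd_double_half j) oi oj ij.
  move/(nth1 _ _ hi hj) => ij; apply: val_inj.
  by rewrite /= -(odd_double_half i) -(odd_double_half j) oi oj ij.
(* Adjacency means being a successor in one of the two directions; one direction suffices, by
   symmetry of edges. *)
have key (i j : cycle_graph (2 * m)) : (val i).+1 %% (2 * m) == val j ->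
    sedge (f i) (f j) /\ c [set f i; f j] = k.
  move/eqP=> ij.
  have hi := half_lt i.
  have /andP[/eqP c1 /eqP c2] := nxt _ hi.
  have i_lt : val i < 2 * m := ltn_ord i.
  rewrite /f -ij; case: ifP => oi.
    have [-> ->] := odd_next i_lt oi.
    by rewrite /= setUC.
  by have [-> ->] := even_next i_lt (negbT oi).
move=> i j /andP[_ /orP[/key//|/key[sji <-]]].
by rewrite setUC sedge_sym.
Qed.

(** The edges joining positions 2t and 2t + 1 form a perfect matching of the cycle, and each has
    exactly one left end in the copy. Which of the two positions that is depends on how the copy is
    placed, hence the description through [v./2 = t]. *)
Lemma mono_copy_left_vertices k m (P : pred nat) :
  (forall i j, coloured k i j -> P i) ->
  mono_copy (cycle_graph (2 * m)) c k ->
  exists l : seq nat, [/\ uniq l, size l = m & {in l, forall i, P i && (i < b)}].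
Proof.
move=> Pk [f [f_inj fe]].
have e0 (t : 'I_m) : 2 * t < 2 * m by have := ltn_ord t; lia.
have e1 (t : 'I_m) : (2 * t).+1 < 2 * m by have := ltn_ord t; lia.
have /fin_all_exists[h hP] : forall t : 'I_m, exists i : 'I_b,
    P i /\ exists2 v : 'I_(2 * m), v./2 = t & f v = inl i.
  move=> t.
  have [] := fe (Ordinal (e0 t)) (Ordinal (e1 t)).
    rewrite /= /cycle_rel -val_eqE /= modn_small ?e1 // eqxx andbT.
    by lia.
  case f0: (f _) => [i|j]; case f1: (f _) => [i'|j'] //= _ ck.
    exists i; split; first by apply: (Pk i j'); rewrite /coloured ck.
    by exists (Ordinal (e0 t)) => //=; lia.
  exists i'; split; first by apply: (Pk i' j); rewrite /coloured setUC ck.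
  by exists (Ordinal (e1 t)) => //=; lia.
have h_inj : injective h.
  move=> t t' tt; have [_ [v vt fv]] := hP t; have [_ [v' vt' fv']] := hP t'.
  apply: val_inj; rewrite /= -vt -vt'; congr (_./2); congr val.
  by apply: f_inj; rewrite fv fv' tt.
exists [seq val (h t) | t <- enum 'I_m]; split.
- by rewrite map_inj_uniq ?enum_uniq // => t t' /val_inj/h_inj.
- by rewrite size_map size_enum_ord.
- by move=> _ /mapP[t _ ->]; rewrite (hP t).1 ltn_ord.
Qed.

End Colouring.

(** * The lower bound *)

Lemma not_bip_arrows n b : 3 < n -> b <= n + 2 ->
  ~ bip_arrows b (cycle_graph 8) (cycle_graph (2 * n)).
Proof.
move=> n_gt3 bn.
pose c : edge_coloring (complete_bipartite b b) :=
  fun A => [exists i : 'I_b, (inl i \in A) && (i < 3)].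
have cE i j : c [set inl i; inr j] = (i < 3).
  apply/existsP/idP => [[i']|i3]; last by exists i; rewrite !inE eqxx.
  by rewrite !inE orbF => /andP[/eqP-[->]].
(* A red C_8 would need 4 left vertices among the 3 chosen ones, and a blue cycle [n] left vertices
   among the other [b - 3], of which there are at most [n - 1]. *)
case/(_ c) => [/(@mono_copy_left_vertices _ _ _ 4 (fun i => i < 3))|
               /(@mono_copy_left_vertices _ _ _ n (fun i => 2 < i))] [].
- by move=> i j; rewrite /coloured cE => /eqP.
- move=> l [ul szl lP]; have := @uniq_leq_size _ l (iota 0 3) ul.
  rewrite szl => h; suff : 4 <= 3 by [].
  by apply: h => i /lP; rewrite mem_iota; lia.
- by move=> i j; rewrite /coloured cE => /eqP; lia.
- move=> l [ul szl lP]; have := @uniq_leq_size _ l (iota 3 (b - 3)) ul.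
  rewrite szl size_iota => h.
  suff : n <= b - 3 by lia.
  by apply: h => i /lP; rewrite mem_iota; lia.
Qed.

(** The blue of the certificate is colour [k] here and its red is [~~ k], so each certificate serves
    both colours. *)
Lemma longer_coloured_cycle (b : nat)
    (c : edge_coloring (complete_bipartite b b)) k m r closed qs ts l :
  certified m r closed qs ts ->
  0 < m -> m <= l -> (closed -> l = m) -> l + r <= b ->
  ~ has_alt_cycle (coloured c (~~ k)) 4 ->
  has_alt_cycle (coloured c k) l -> has_alt_cycle (coloured c k) l.+1.
Proof.
move=> cert m_gt0 ml cl lb no [s szs cs]; subst l.
have E : (fun x y => ~~ coloured c (~~ k) x y) =2 coloured c k.
  by move=> x y; rewrite /coloured; case: (c _) (k) => [] [].
apply: (eq_has_alt_cycle E).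
apply: (longer_alt_cycle (s := s) m_gt0 cert); rewrite ?card_ord //.
case/and3P: cs => u1 u2 cs; apply/and3P; split=> //.
by rewrite (eq_cycle (e' := alt (coloured c k))) // => u v; rewrite /alt !E.
Qed.

(** * Certificates *)

(* The paths and the refutations below come from a lookahead tree search; in
   the flat lists of [pairs], [x] and [y] indices alternate. *)
Fixpoint pairs (l : seq nat) : seq edge :=
  if l is x :: y :: l' then (x, y) :: pairs l' else [::].

Definition C4_to_C6_paths : seq (seq edge) := map pairs [::
  [:: 0;2;2;0;1;1]; [:: 0;2;3;0;1;1]; [:: 0;0;2;2;1;1]; [:: 0;0;2;3;1;1];
  [:: 0;0;3;2;1;1]; [:: 0;0;1;1;3;2]; [:: 0;3;2;0;1;1]; [:: 0;0;3;3;1;1];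
  [:: 0;0;2;5;1;1]; [:: 0;0;1;1;5;2]; [:: 0;0;1;4;4;1]; [:: 0;0;2;4;1;1];
  [:: 0;0;1;1;2;3]; [:: 0;0;1;1;3;3]; [:: 0;0;1;1;4;2]; [:: 0;0;1;1;2;2];
  [:: 0;2;4;0;1;1]; [:: 0;0;3;4;1;1]; [:: 0;4;2;0;1;1]; [:: 0;0;1;1;5;3];
  [:: 0;0;1;1;4;3]; [:: 0;3;3;0;1;1]; [:: 0;0;1;3;4;1]; [:: 0;0;1;2;5;1];
  [:: 0;0;1;5;4;1]; [:: 0;0;3;5;1;1]; [:: 0;4;3;0;1;1]; [:: 0;3;4;0;1;1];
  [:: 0;0;1;2;6;1]; [:: 0;0;4;2;1;1]; [:: 0;0;1;5;5;1]; [:: 0;4;4;1;1;0];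
  [:: 0;0;4;4;1;1]; [:: 0;0;1;2;3;1]; [:: 0;0;1;4;3;1]; [:: 0;0;1;4;5;1];
  [:: 0;0;1;3;5;1]; [:: 0;4;3;1;1;0]; [:: 0;0;4;3;1;1]; [:: 0;4;5;1;1;0];
  [:: 0;0;4;5;1;1]; [:: 0;0;1;1;2;5]; [:: 0;5;3;0;1;1]; [:: 0;4;4;0;1;1];
  [:: 0;2;5;0;1;1]; [:: 0;3;5;0;1;1]; [:: 0;0;3;6;1;1]; [:: 0;0;1;2;2;1];
  [:: 0;4;2;1;1;0]; [:: 0;0;1;2;4;1]; [:: 0;0;1;6;4;1]; [:: 0;0;1;6;5;1];
  [:: 0;0;1;4;2;1]; [:: 0;0;5;4;1;1]; [:: 0;2;1;1;2;0]; [:: 1;0;2;5;3;1];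
  [:: 0;0;3;2;2;1]; [:: 0;0;3;6;2;1]; [:: 0;1;3;4;2;0]; [:: 0;0;2;3;3;1];
  [:: 0;2;6;4;1;1]; [:: 0;0;3;6;5;1]; [:: 0;2;5;3;1;1]; [:: 1;0;2;6;5;1];
  [:: 0;0;1;4;5;3]; [:: 0;0;4;3;2;1]; [:: 0;1;1;2;4;4]; [:: 0;2;1;1;3;0];
  [:: 0;2;6;3;1;1]; [:: 0;0;4;3;3;1]; [:: 1;0;2;5;4;1]; [:: 0;1;1;5;6;4];
  [:: 0;2;5;4;1;1]; [:: 0;0;4;4;2;1]; [:: 0;0;2;4;4;1]; [:: 0;0;3;3;4;1];
  [:: 1;0;3;4;6;1]; [:: 0;1;1;5;3;3]; [:: 0;2;3;3;1;0]; [:: 0;1;1;3;3;4];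
  [:: 0;1;1;5;4;2]; [:: 0;0;2;3;4;1]; [:: 0;0;3;3;2;1]; [:: 0;0;1;6;4;3];
  [:: 0;0;3;4;4;1]; [:: 1;0;2;5;5;1]; [:: 0;0;2;2;4;1]; [:: 0;0;4;5;5;1];
  [:: 0;1;1;2;5;4]; [:: 0;0;4;2;2;1]; [:: 0;1;1;2;3;4]; [:: 0;0;1;3;2;2];
  [:: 0;0;1;4;2;3]; [:: 0;0;4;6;3;1]; [:: 0;0;4;6;6;1]; [:: 0;0;2;2;3;1];
  [:: 0;0;3;2;4;1]; [:: 0;1;1;2;3;3]; [:: 0;1;1;2;2;4]; [:: 0;0;4;5;3;1];
  [:: 1;0;2;6;4;1]; [:: 0;0;3;6;4;1]; [:: 0;0;1;3;2;4]; [:: 0;2;1;1;4;0];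
  [:: 0;0;4;5;2;1]; [:: 0;2;6;5;1;1]; [:: 0;1;1;5;2;4]; [:: 0;0;1;4;3;2];
  [:: 0;0;1;6;3;4]; [:: 0;2;5;5;1;1]; [:: 0;0;3;4;2;1]; [:: 0;2;2;5;1;1];
  [:: 1;0;2;5;6;1]; [:: 0;0;4;2;3;1]; [:: 0;0;1;4;2;2]; [:: 0;1;1;5;4;4];
  [:: 0;2;6;6;2;0]; [:: 0;2;5;6;3;0]; [:: 0;2;4;6;2;0]; [:: 0;3;5;6;2;0];
  [:: 3;5;4;4;5;6]; [:: 2;4;5;5;4;6]; [:: 2;5;4;4;6;3]; [:: 3;4;4;6;6;2];
  [:: 3;5;6;4;4;6]; [:: 3;5;6;6;5;4]; [:: 2;5;4;4;6;2]; [:: 2;4;4;6;6;2];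
  [:: 0;3;6;4;5;2]; [:: 2;5;4;6;3;0]; [:: 3;4;4;3;5;2]; [:: 3;3;6;4;4;6];
  [:: 3;5;5;6;4;1]; [:: 0;3;4;5;5;4]; [:: 2;4;4;6;6;3]; [:: 2;4;5;6;3;0];
  [:: 3;5;5;6;4;2]; [:: 2;5;4;4;6;6]; [:: 3;5;5;3;6;2]; [:: 3;3;4;6;5;2];
  [:: 3;5;5;6;4;3]; [:: 2;4;3;5;4;0]; [:: 2;4;4;5;5;2]; [:: 2;6;4;4;3;0];
  [:: 2;4;4;2;6;5]; [:: 2;5;3;4;4;0]; [:: 2;3;5;6;6;2]; [:: 3;3;5;4;6;2];
  [:: 0;3;4;5;5;2]; [:: 0;3;6;4;4;2]; [:: 3;5;4;6;6;4]; [:: 1;5;5;6;4;4];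
  [:: 0;4;5;5;4;2]; [:: 3;4;4;2;5;6]; [:: 2;4;5;5;3;0]; [:: 0;3;4;4;6;2];
  [:: 3;5;5;2;6;3]; [:: 2;4;5;6;4;5]; [:: 2;5;4;4;5;6]; [:: 3;4;4;3;6;6];
  [:: 2;5;4;3;6;6]; [:: 0;3;4;5;6;2]; [:: 1;2;6;6;4;4]; [:: 2;5;3;1;4;4];
  [:: 1;2;6;4;4;3]; [:: 2;4;4;2;5;5]; [:: 1;5;4;4;6;3]; [:: 3;5;5;2;4;1];
  [:: 3;3;5;4;6;6]; [:: 3;5;4;6;5;4]; [:: 0;3;5;5;3;4]; [:: 0;3;4;2;5;4];
  [:: 3;5;5;3;6;6]; [:: 2;5;4;6;6;2]; [:: 2;5;4;4;3;0]; [:: 3;3;6;6;5;2];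
  [:: 1;5;5;6;6;4]; [:: 3;3;4;4;5;6]; [:: 1;2;6;4;5;3]; [:: 1;5;5;6;6;3];
  [:: 3;4;4;2;5;3]; [:: 3;5;6;6;4;4]; [:: 2;5;3;3;4;4]; [:: 2;4;3;6;4;0];
  [:: 2;5;4;4;5;2]; [:: 0;4;4;6;5;3]; [:: 2;6;4;5;3;0]; [:: 0;3;2;5;3;4];
  [:: 0;3;6;2;4;4]; [:: 3;5;5;1;4;6]; [:: 2;6;3;4;6;5]; [:: 2;5;6;6;4;0];
  [:: 0;4;4;2;5;3]; [:: 2;4;4;5;5;3]; [:: 2;4;5;5;4;0]; [:: 2;4;5;6;3;5];
  [:: 1;2;4;6;5;3]; [:: 2;4;4;6;6;5]; [:: 3;3;6;4;5;6]; [:: 2;5;3;6;5;3];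
  [:: 0;3;3;6;5;4]; [:: 0;3;4;4;5;2]; [:: 0;3;6;5;3;4]; [:: 3;5;6;6;4;0];
  [:: 3;4;4;3;6;2]; [:: 3;4;4;2;6;3]; [:: 2;6;4;4;6;5]; [:: 0;3;4;2;5;5];
  [:: 0;3;6;5;2;4]; [:: 0;4;4;5;5;2]; [:: 2;5;6;4;3;0]; [:: 3;3;6;6;4;2];
  [:: 3;3;4;2;6;6]; [:: 3;5;5;6;6;3]; [:: 0;4;5;5;6;2]; [:: 2;4;5;0;4;5];
  [:: 2;4;5;0;3;5]; [:: 1;5;4;3;6;4]; [:: 2;6;4;0;3;5]].

Definition C4_to_C6_refutation : seq token := [::
  B 4 0; B 0 4; B 1 2; B 5 1; U; U; U; F 5 3; U; U; U; F 5 2; F 5 3; F 5 4; U;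
  B 1 5; U; U; U; F 3 5; U; U; U; F 2 5; F 3 5; U; F 4 1; B 1 5; B 0 2; U; U;
  U; F 2 6; F 3 6; F 4 6; U; F 3 1; U; U; U; F 3 2; U; B 0 3; B 1 3; B 5 1; U;
  U; U; F 6 1; F 6 2; U; B 5 0; B 5 4; B 2 4; B 2 5; U; U; U; F 3 5; U; U; U;
  F 3 5; F 3 6; F 4 4; F 4 5; F 5 6; U; U; U; U; F 3 5; F 3 6; F 4 4; F 4 5;
  F 5 6; U; U; U; U; F 2 5; F 3 6; F 4 5; F 4 6; U; U; U; U; F 5 2; F 5 3; U;
  U; U; U; F 2 5; F 3 6; F 4 5; F 4 6; U; B 1 4; U; U; U; F 2 5; F 3 6; F 4 5;
  F 4 6; U; B 2 2; B 2 1; B 3 4; B 4 5; U; U; F 3 3; F 3 5; F 3 6; F 4 3;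
  F 4 4; B 5 1; U; F 5 5; U; F 5 4; F 5 6; U; U; U; F 2 6; F 3 6; U; U; U;
  F 4 3; F 4 5; U; F 2 5; B 2 6; B 2 5; B 2 4; B 5 1; U; U; U; F 6 5; F 6 6; U;
  F 4 6; B 3 5; U; U; U; F 5 4; F 5 5; U; U; U; U; F 4 4; F 4 6; F 5 4; F 5 6;
  U; F 4 5; U; U; U; F 3 6; F 4 5; F 4 6; U; U; U; U; F 3 4; F 4 4; F 4 6; U;
  U; U; U; F 3 4; F 3 5; F 4 4; F 4 5; U; F 3 6; B 5 1; U; F 5 5; F 5 4; F 5 6;
  U; B 1 3; B 0 2; U; U; F 2 5; U; F 3 6; F 4 5; F 4 6; U; U; U; F 2 5; U;
  F 3 6; F 4 5; F 4 6; U; B 3 1; B 3 2; B 2 3; U; U; U; F 2 5; F 3 5; U; U;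
  F 4 5; F 4 6; U; F 3 5; B 2 3; U; U; U; F 2 4; F 2 5; F 2 6; U; F 4 4; U;
  F 3 4; F 3 5; F 3 6; U; U; F 4 5; B 3 6; B 3 3; B 3 4; B 5 1; U; U; F 6 4;
  F 6 5; U; F 2 1; F 4 3; F 4 5; F 5 2; U; F 5 5; B 4 6; B 3 2; B 2 1; B 6 6;
  B 3 5; U; U; F 4 4; F 6 2; U; U; U; F 4 4; F 6 2; U; U; U; F 6 3; F 6 4; U;
  F 4 4; U; U; U; F 3 5; F 4 4; F 4 5; F 5 4; F 5 6; U; U; U; U; F 3 5; F 4 3;
  F 5 5; F 5 6; U; U; F 3 5; F 5 3; F 5 4; F 5 5; U; U; F 2 1; F 3 2; F 4 2;
  F 5 2; U; F 4 4; U; F 4 3; F 4 5; F 4 6; U; U; F 2 1; F 3 2; F 4 2; U; F 3 5;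
  B 5 1; U; F 5 5; F 5 5; F 5 6; U; U; F 4 4; F 4 5; F 4 6; U; U; F 2 1; F 3 2;
  U; F 3 5; B 5 1; U; F 5 5; F 5 4; F 5 6; U; U; F 4 3; F 4 4; F 4 5; B 5 1; U;
  F 6 1; F 6 4; F 6 6; U; F 4 6; F 5 3; F 5 4; F 5 5; U; U; F 2 1; F 3 2;
  F 5 2; U; F 3 4; B 0 4; B 5 1; B 2 0; U; U; U; F 6 2; F 6 3; F 6 4; U; F 1 3;
  U; U; U; F 2 3; U; B 3 0; B 3 1; B 2 5; U; U; U; F 1 6; B 0 5; B 4 2; B 4 3;
  B 5 2; U; U; U; F 5 5; U; U; U; F 4 5; F 5 4; F 5 5; U; U; U; U; F 4 5;
  F 5 4; F 5 5; U; U; U; U; F 4 3; F 4 5; F 5 4; F 5 5; U; U; U; U; F 1 6;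
  F 3 6; U; U; U; U; F 5 2; F 5 4; F 6 3; F 6 4; U; B 4 1; U; U; U; F 5 2;
  F 5 4; F 6 3; F 6 4; U; B 2 4; B 1 3; B 6 3; U; U; U; F 3 3; F 4 3; F 5 3; U;
  F 4 4; F 5 4; F 6 4; B 1 5; U; F 3 5; U; F 4 5; F 5 5; U; U; U; U; F 3 2;
  F 4 2; F 5 2; U; F 5 4; B 1 5; U; F 3 6; F 4 6; B 1 6; U; F 3 4; F 3 3;
  F 4 4; F 6 3; F 6 4; U; B 6 3; B 2 5; U; U; F 3 3; F 4 3; F 4 4; F 5 4; U;
  F 1 2; F 4 2; U; U; F 4 3; F 4 4; F 5 4; F 6 4; U; U; F 4 5; F 5 5; U; U;
  F 2 5; F 3 4; F 3 5; F 4 4; F 4 5; F 5 4; F 5 5; U; U; F 5 2; B 2 2; B 1 2;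
  B 1 3; B 3 3; U; U; F 5 2; U; F 5 3; U; U; U; F 4 4; F 5 4; U; F 5 2; U;
  F 3 3; F 4 3; B 1 5; U; U; F 4 2; F 4 4; U; F 4 5; F 5 5; U; F 5 2; U; U; U;
  U; F 3 2; F 3 3; F 4 2; F 4 3; F 5 2; F 5 3; F 6 2; F 6 3; B 1 5; U; F 4 5;
  U; F 3 5; F 5 5; U; B 3 1; U; F 4 2; U; U; F 4 4; F 6 2; F 6 4; U; F 1 3;
  B 3 4; B 1 4; U; U; U; F 5 4; F 6 4; U; F 5 3; B 4 4; B 6 4; B 5 4; B 1 5; U;
  F 3 6; F 4 6; F 5 6; U; F 3 3; B 4 2; U; U; U; F 4 5; F 5 5; U; F 3 5; U;
  F 5 5; F 6 5; U; F 6 2; U; F 4 2; U; F 6 2; U; U; F 1 3; U; F 4 2; F 5 2; U;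
  F 1 3; U; F 3 2; F 6 2; U; F 2 0; F 3 3; F 5 3; F 6 3; B 1 5; U; F 3 5;
  F 3 5; F 5 5; U; U; F 4 2; F 5 2; F 6 2; B 1 2; U; F 3 2; U; F 2 3; F 5 3; U;
  F 1 4; U; F 2 0; F 5 3; F 6 3; U; F 3 2; F 3 3; B 1 5; U; F 3 5; F 3 5;
  F 5 5; U; B 5 1; B 1 6; B 2 0; U; U; F 2 4; U; U; U; F 3 4; U; B 4 2; B 4 6;
  B 3 0; U; U; F 2 4; F 2 5; U; F 4 4; B 6 6; B 5 2; B 5 5; U; U; U; F 4 3;
  F 4 4; F 6 2; B 2 0; U; F 3 2; F 3 4; U; F 2 2; F 2 4; U; U; F 3 2; F 3 4;
  F 4 4; F 6 2; U; U; U; F 3 5; F 3 6; F 4 4; F 6 4; F 6 5; U; U; U; F 3 2;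
  F 3 4; F 4 3; F 4 4; F 5 2; F 5 3; U; U; U; F 5 2; F 5 5; B 3 0; U; U; F 3 3;
  F 4 3; U; F 3 5; U; B 1 5; U; U; F 1 2; F 6 2; U; F 6 4; B 2 0; U; F 2 3; U;
  U; U; F 3 2; B 5 2; U; F 5 4; F 5 5; F 5 6; F 6 5; F 6 6; B 3 0; U; U; F 3 3;
  F 4 3; U; F 3 4; F 3 5; U; B 1 2; B 3 2; U; B 5 4; B 4 4; B 2 0; U; U; F 3 5;
  F 3 6; F 4 5; F 5 6; U; B 2 4; B 3 6; B 2 6; B 5 6; B 4 3; U; U; U; U; F 4 5;
  F 4 6; F 5 5; U; B 2 5; U; F 0 3; F 2 3; U; U; F 0 3; U; U; U; F 3 5; F 4 5;
  U; U; F 2 5; F 3 5; U; U; F 3 5; F 6 4; F 6 5; U; F 2 5; U; U; F 2 5; F 4 5;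
  F 5 5; U; U; F 2 6; F 4 6; U; U; U; U; U; F 3 5; F 3 6; F 4 5; F 5 6; U; U;
  F 3 5; F 3 6; F 5 5; F 5 6; F 6 5; F 6 6; U; F 4 6; U; F 3 5; F 3 6; F 4 6;
  F 6 5; U; F 4 4; F 6 4; U; U; F 4 4; F 4 5; F 4 6; F 5 5; F 5 6; B 3 0; U; U;
  F 0 2; F 2 2; U; U; F 3 5; U; B 4 4; B 4 5; B 1 5; B 6 4; B 0 3; B 2 0; U; U;
  F 5 3; F 5 4; U; B 2 3; U; U; F 3 5; F 5 4; U; F 3 3; U; U; F 4 3; F 6 3; U;
  U; U; U; F 4 6; F 5 5; F 5 6; U; U; F 4 6; F 5 5; F 5 6; U; B 4 6; B 5 4;
  B 6 4; B 1 4; B 6 2; U; U; U; F 4 3; B 0 2; B 3 0; U; U; F 2 5; F 3 1; F 3 5;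
  U; B 2 2; U; F 3 5; F 3 6; F 5 6; U; B 2 4; B 2 5; U; F 3 5; F 3 6; F 6 5; U;
  U; F 3 5; F 3 6; F 5 6; U; U; F 3 5; F 3 6; F 5 6; U; U; F 5 6; B 3 0; U; U;
  F 2 5; F 3 1; F 3 5; U; F 3 5; F 3 6; U; B 5 6; B 2 5; B 2 0; B 2 2; U;
  F 2 1; F 6 3; B 3 0; U; F 3 6; F 3 5; F 3 6; U; B 3 5; U; F 0 2; F 1 2;
  F 2 1; U; U; F 3 2; B 0 2; U; F 2 1; F 6 2; F 6 6; U; F 3 4; U; F 3 3; F 3 6;
  U; F 6 3; U; F 3 5; F 3 6; U; B 2 0; B 2 2; B 3 5; U; F 2 4; F 2 6; U; F 3 0;
  B 3 1; U; F 2 4; F 2 6; U; F 6 2; F 6 6; U; U; F 5 3; F 6 2; F 6 6; U; F 3 2;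
  F 3 4; U; B 3 2; B 6 6; B 3 5; U; F 0 2; F 1 2; U; F 2 1; B 0 2; U; F 6 2; U;
  F 1 2; F 2 1; U; U; F 3 4; F 3 6; U; F 3 1; F 6 3; U; F 3 3; U; F 4 2; F 5 2;
  F 5 5; U; F 3 0; U; F 3 4; F 4 3; F 5 3; U; U; F 3 4; F 3 6; U; F 2 4; F 2 6;
  U; F 5 5; U; F 3 4; F 3 6; F 6 6; U; F 2 4; F 2 6; B 2 2; U; F 0 2; F 3 2;
  F 4 2; U; F 5 2; U; F 3 2; F 6 2; U; U; F 6 5; B 2 0; B 4 2; B 0 3; U; U;
  F 6 3; F 4 3; F 6 3; B 6 2; B 3 3; U; F 3 0; F 3 1; U; F 2 4; F 2 6; F 5 5;
  U; F 3 0; F 3 1; B 3 4; U; F 1 2; F 2 2; U; F 5 3; F 5 5; B 2 3; U; F 2 4;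
  F 2 6; U; U; F 2 4; F 0 2; U; F 2 6; F 0 2; F 1 2; U; F 2 5; F 2 6; F 6 6; U;
  F 2 4; F 2 5; U; F 3 4; F 3 5; F 5 5; B 2 2; U; F 0 2; F 3 1; F 3 2; U;
  F 4 2; U; F 6 2; U; F 5 5; F 5 6; B 3 0; B 3 1; B 0 2; U; F 4 2; F 5 2; U;
  F 2 5; F 3 5; U; F 4 2; U; F 4 3; B 1 3; U; F 5 3; U; U; F 5 2; F 5 3; B 3 6;
  U; F 3 4; B 3 3; U; F 2 4; F 2 6; U; F 6 2; F 6 6; B 2 2; U; F 2 3; F 2 4;
  F 2 6; U; F 3 5; F 3 6; U; F 3 5; F 3 6; U; U; F 6 5; F 6 6; B 3 4; U; F 3 0;
  F 3 1; B 0 2; U; U; F 3 2; U; U; F 3 2; F 6 2; U; B 4 3; B 3 0; B 1 2; U; U;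
  F 2 1; F 2 5; F 2 6; U; F 2 4; F 4 2; F 6 2; B 0 2; U; U; F 2 6; U; F 6 3;
  B 3 3; U; F 3 1; F 5 5; F 5 6; U; F 2 2; F 2 4; U; F 3 1; B 2 2; U; F 2 5;
  F 2 3; F 2 4; U; F 3 5; F 5 5; F 5 6; U; F 0 3; U; U; F 6 2; F 0 3; F 1 3;
  F 3 3; U; U; F 6 2; F 6 3; U; U; F 5 4; F 5 5; F 6 4; F 6 5; B 0 2; B 3 5;
  B 3 4; B 4 1; U; U; F 5 6; F 6 6; U; B 1 4; U; F 3 6; F 5 6; U; B 2 2; U;
  F 2 4; F 2 5; U; F 3 6; F 5 6; U; B 5 2; B 2 0; B 1 3; U; F 1 2; F 2 6;
  F 6 2; U; F 6 6; F 5 3; F 6 3; B 1 2; U; F 2 3; F 2 5; U; U; F 6 2; U; F 2 5;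
  F 3 1; U; F 2 4; F 2 5; U; F 5 6; F 6 6; U; F 1 2; F 2 5; F 2 6; U; F 2 0;
  F 2 1; U; F 3 0; F 3 1; U; U; F 2 5; F 3 1; U; F 6 2; U; F 3 0; F 4 2; U; U;
  F 2 4; F 2 6; U; F 2 5; F 5 2; U; F 5 3; F 6 2; F 6 3; B 3 2; U; F 3 0;
  F 3 1; U; U; F 2 3; F 2 5; U; F 3 0; F 3 1; B 3 3; U; U; F 2 2; F 2 5; U;
  B 2 2; U; U; F 2 4; F 2 5; F 2 6; U; U; F 2 3; U; F 5 4; F 5 6; F 6 4; F 6 6;
  B 1 5; U; U; F 4 6; B 5 2; U; F 6 2; U; F 0 2; B 2 0; U; F 2 5; U; F 3 1;
  F 3 2; U; B 0 2; B 3 6; B 3 0; U; U; F 2 4; U; F 3 4; B 6 3; U; F 0 3; U;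
  F 4 2; F 0 3; B 3 3; U; F 3 5; F 6 5; U; F 3 5; U; F 3 1; F 4 1; U; F 4 2;
  F 3 1; U; F 6 2; U; F 3 0; U; U; F 2 5; F 3 5; U; U; F 5 3; F 6 2; F 6 3;
  B 3 3; U; F 3 0; F 3 1; U; U; F 2 2; F 2 4; F 4 6; U; F 3 0; F 3 1; B 1 2; U;
  U; F 2 4; F 2 5; F 4 6; U; F 2 3; B 3 6; U; U; F 3 2; F 3 4; F 4 6; U; U;
  F 4 6; B 2 2; U; F 2 3; F 2 3; F 2 4; U; U; F 5 5; F 5 6; F 6 5; F 6 6;
  B 1 5; U; U; F 4 5; B 0 3; B 2 0; U; U; F 2 5; U; U; F 3 1; F 3 2; U; U;
  F 6 3; U; B 2 0; B 5 3; B 0 3; U; F 2 1; F 4 3; U; F 5 2; F 4 5; U; F 6 3;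
  B 3 5; U; F 3 0; F 3 1; F 4 5; U; F 2 4; U; F 2 6; F 4 6; U; U; F 3 0; F 3 1;
  B 3 2; U; F 5 2; U; F 2 5; F 2 6; F 4 3; F 4 5; U; F 6 2; B 2 2; U; F 2 5;
  F 2 6; F 4 3; F 4 5; U; F 2 3; F 2 4; U; F 2 5; F 2 6; F 4 3; F 4 5; U;
  F 0 3; F 1 3; U; U; F 2 6; F 4 2; U; F 6 2; U; F 2 5; F 2 6; F 3 5; F 3 6;
  B 6 3; U; F 3 4; F 6 4; U; F 0 3; B 2 3; U; F 3 4; F 5 4; U; F 2 4; F 5 4; U].

Definition C6_to_C8_paths : seq (seq edge) := map pairs [::
  [:: 0;3;3;0;1;1;2;2]; [:: 0;3;4;2;2;1;1;0]; [:: 0;0;3;4;1;1;2;2];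
  [:: 0;3;5;2;2;1;1;0]; [:: 0;3;4;0;1;1;2;2]; [:: 0;0;1;1;3;4;2;2];
  [:: 0;3;6;2;2;1;1;0]; [:: 0;0;3;3;1;1;2;2]; [:: 0;3;3;2;2;1;1;0];
  [:: 0;0;1;1;3;3;2;2]; [:: 0;4;3;0;1;1;2;2]; [:: 0;0;3;5;1;1;2;2];
  [:: 0;0;1;3;6;1;2;2]; [:: 0;0;1;1;4;5;2;2]; [:: 0;0;1;1;3;5;2;2];
  [:: 0;0;1;1;4;4;2;2]; [:: 0;0;1;3;4;1;2;2]; [:: 0;0;1;5;5;1;2;2];
  [:: 0;0;1;1;2;2;5;4]; [:: 0;0;1;1;2;2;4;4]; [:: 0;0;1;1;5;3;2;2];
  [:: 0;3;7;2;2;1;1;0]; [:: 0;0;1;1;2;2;3;4]; [:: 0;0;3;6;1;1;2;2];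
  [:: 0;0;1;1;2;2;6;4]; [:: 0;0;4;6;1;1;2;2]; [:: 0;0;4;5;1;1;2;2];
  [:: 0;0;1;1;2;5;5;2]; [:: 0;0;1;5;4;1;2;2]; [:: 0;0;1;4;3;1;2;2];
  [:: 0;0;1;1;4;3;2;2]; [:: 0;0;1;6;4;1;2;2]; [:: 0;0;4;4;1;1;2;2];
  [:: 0;0;1;6;5;1;2;2]; [:: 0;3;5;0;1;1;2;2]; [:: 0;0;1;1;5;4;2;2];
  [:: 0;5;3;0;1;1;2;2]; [:: 0;0;1;1;2;3;4;2]; [:: 0;0;1;1;2;5;4;2];
  [:: 0;4;4;0;1;1;2;2]; [:: 0;0;4;3;1;1;2;2]; [:: 0;0;1;1;2;6;3;2];
  [:: 0;0;1;1;2;2;3;5]; [:: 0;0;1;1;2;4;3;2]; [:: 0;0;1;1;5;5;2;2];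
  [:: 0;0;1;5;3;1;2;2]; [:: 0;0;1;4;6;1;2;2]; [:: 0;0;3;7;1;1;2;2];
  [:: 0;0;1;1;2;2;7;4]; [:: 0;0;1;3;5;1;2;2]; [:: 0;0;1;1;2;2;6;5];
  [:: 0;0;1;1;4;6;2;2]; [:: 0;0;1;5;6;1;2;2]; [:: 0;0;1;6;6;1;2;2];
  [:: 0;5;4;0;1;1;2;2]; [:: 0;4;5;0;1;1;2;2]; [:: 0;0;1;1;2;6;5;2];
  [:: 0;0;1;1;2;6;6;2]; [:: 0;0;1;1;2;5;3;2]; [:: 0;0;1;1;2;2;4;5];
  [:: 0;0;1;3;3;1;2;2]; [:: 0;0;1;4;4;1;2;2]; [:: 0;0;1;6;3;1;2;2];
  [:: 0;0;1;1;2;6;4;2]; [:: 0;0;1;1;2;4;5;2]; [:: 0;0;1;1;2;2;5;5];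
  [:: 0;0;1;1;3;7;2;2]; [:: 0;0;1;4;5;1;2;2]; [:: 0;0;1;1;2;7;5;2];
  [:: 0;0;5;4;1;1;2;2]; [:: 0;0;5;5;1;1;2;2]; [:: 0;0;1;1;2;2;7;5];
  [:: 0;0;1;1;6;6;2;2]; [:: 0;0;5;6;1;1;2;2]; [:: 0;5;5;0;1;1;2;2];
  [:: 0;0;1;1;2;6;7;2]; [:: 0;3;6;0;1;1;2;2]; [:: 0;0;1;1;2;3;6;2];
  [:: 0;0;1;1;2;3;3;2]; [:: 0;0;1;1;2;7;4;2]; [:: 0;0;1;1;2;3;5;2];
  [:: 0;0;1;1;2;5;7;2]; [:: 0;0;1;5;7;1;2;2]; [:: 0;0;1;6;7;1;2;2];
  [:: 0;0;1;1;7;6;2;2]; [:: 0;0;1;1;4;7;2;2]; [:: 0;4;6;3;1;1;2;2];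
  [:: 0;2;2;1;3;7;4;0]; [:: 0;3;7;5;1;1;2;2]; [:: 1;0;3;5;4;2;2;1];
  [:: 0;0;1;3;2;1;3;2]; [:: 0;0;1;4;5;5;2;2]; [:: 0;2;2;3;1;1;3;0];
  [:: 0;3;7;5;2;1;1;0]; [:: 0;2;2;0;1;1;5;3]; [:: 0;2;2;1;5;6;3;0];
  [:: 0;0;1;3;5;4;2;2]; [:: 1;1;2;2;5;6;3;0]; [:: 1;1;2;2;6;6;3;0];
  [:: 0;2;2;1;3;5;4;0]; [:: 0;2;2;0;1;1;3;3]; [:: 1;0;3;5;6;2;2;1];
  [:: 0;4;1;1;2;2;3;0]; [:: 0;2;2;1;1;6;6;3]; [:: 0;3;7;4;2;1;1;0];
  [:: 0;4;7;3;1;1;2;2]; [:: 0;0;1;2;2;1;4;3]; [:: 0;3;2;1;1;0;4;2];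
  [:: 0;0;1;3;6;6;2;2]; [:: 1;0;5;7;3;2;2;1]; [:: 0;4;6;5;2;1;1;0];
  [:: 1;1;2;2;4;7;3;0]; [:: 0;2;2;1;3;6;4;0]; [:: 0;2;4;6;3;1;1;0];
  [:: 0;2;2;1;1;6;5;3]; [:: 0;2;6;7;3;1;1;0]; [:: 0;2;2;4;1;1;3;0];
  [:: 0;2;5;7;3;1;1;0]; [:: 0;2;2;1;4;5;3;0]; [:: 0;0;1;3;6;5;2;2];
  [:: 1;1;2;2;4;3;3;0]; [:: 0;2;6;5;3;1;1;0]; [:: 0;3;7;4;1;1;2;2];
  [:: 0;1;2;2;3;4;1;0]; [:: 0;2;2;1;5;7;3;0]; [:: 1;1;2;2;7;7;3;0];
  [:: 0;0;1;5;6;6;2;2]; [:: 0;2;1;1;2;4;3;0]; [:: 0;2;2;0;1;1;4;4];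
  [:: 0;4;6;5;1;1;2;2]; [:: 0;2;2;0;1;1;5;4]; [:: 0;1;1;0;4;5;2;2];
  [:: 0;1;2;2;4;5;1;0]; [:: 0;0;1;5;7;6;2;2]; [:: 0;0;1;2;2;1;4;4];
  [:: 1;1;2;2;5;7;3;0]; [:: 0;0;2;1;1;5;6;2]; [:: 0;0;1;3;5;5;2;2];
  [:: 0;0;1;3;2;1;4;2]; [:: 0;4;6;3;2;1;1;0]; [:: 0;1;1;0;4;6;2;2];
  [:: 0;4;2;1;1;0;3;2]; [:: 0;1;1;0;3;6;2;2]; [:: 0;2;5;5;3;1;1;0];
  [:: 0;2;2;0;1;1;3;4]; [:: 0;0;3;7;7;1;2;2]; [:: 0;4;7;3;2;1;1;0];
  [:: 0;1;2;2;6;5;1;0]; [:: 0;0;1;3;2;1;5;2]; [:: 0;2;2;0;1;1;4;3];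
  [:: 0;1;1;0;4;3;2;2]; [:: 0;0;1;3;5;6;2;2]; [:: 0;2;3;5;4;1;1;0];
  [:: 0;2;1;1;2;3;3;0]; [:: 0;2;1;1;2;5;3;0]; [:: 0;0;1;3;6;4;2;2];
  [:: 0;0;1;5;5;6;2;2]; [:: 0;2;2;1;1;6;4;4]; [:: 0;2;2;1;5;0;1;3];
  [:: 1;0;3;5;5;2;2;1]; [:: 0;2;2;1;5;5;3;0]; [:: 0;4;4;7;1;1;2;2];
  [:: 0;4;1;1;2;2;4;0]; [:: 0;2;1;1;2;3;4;0]; [:: 0;2;2;0;1;1;6;3];
  [:: 0;0;2;1;1;4;5;2]; [:: 0;4;6;7;1;1;2;2]; [:: 0;1;1;0;3;4;2;2];
  [:: 0;2;7;5;3;1;1;0]; [:: 0;0;1;3;7;5;2;2]; [:: 0;1;1;0;3;3;2;2];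
  [:: 1;1;2;2;6;3;3;0]; [:: 0;6;6;3;1;1;2;2]; [:: 0;2;3;5;5;1;1;0];
  [:: 0;4;1;1;2;2;5;0]; [:: 0;0;1;5;7;3;2;2]; [:: 0;0;2;1;1;5;5;2];
  [:: 0;0;2;1;1;6;7;2]; [:: 0;2;2;1;4;6;3;0]; [:: 0;1;2;2;4;6;1;0];
  [:: 0;2;2;1;1;6;7;3]; [:: 0;2;7;7;3;1;1;0]; [:: 0;4;5;7;1;1;2;2];
  [:: 0;0;2;1;1;6;6;2]; [:: 1;1;2;2;5;3;3;0]; [:: 0;0;1;3;2;1;7;2];
  [:: 0;2;2;1;1;6;5;4]; [:: 0;1;2;2;4;3;1;0]; [:: 0;1;2;2;5;6;1;0];
  [:: 1;1;2;2;7;6;3;0]; [:: 0;0;1;5;7;4;2;2]; [:: 0;1;1;0;3;5;2;2];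
  [:: 0;2;2;0;1;1;3;5]; [:: 0;0;5;6;7;1;2;2]; [:: 0;1;2;2;5;5;1;0];
  [:: 0;3;2;1;1;0;5;2]; [:: 0;0;2;1;1;5;4;2]; [:: 0;2;2;1;5;6;4;0];
  [:: 0;4;2;1;1;0;4;2]; [:: 0;0;2;1;1;3;5;2]; [:: 0;2;3;7;4;1;1;0];
  [:: 0;0;1;3;7;4;2;2]; [:: 0;0;2;1;1;4;4;2]; [:: 0;0;1;1;7;7;5;2];
  [:: 0;0;1;1;7;7;6;2]; [:: 0;2;2;1;1;6;6;4]; [:: 1;0;5;6;3;2;2;1];
  [:: 0;0;3;6;7;1;2;2]; [:: 0;0;1;2;2;1;4;5]; [:: 0;0;1;3;7;6;2;2];
  [:: 0;2;3;6;6;1;1;0]; [:: 0;2;2;1;3;6;6;0]; [:: 0;0;1;1;3;7;7;3];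
  [:: 0;0;1;1;3;7;5;3]; [:: 0;2;2;5;4;7;5;0]; [:: 0;0;1;1;3;7;6;3];
  [:: 0;0;1;1;3;7;4;3]; [:: 0;0;1;1;3;7;7;4]; [:: 0;2;2;5;7;6;3;0];
  [:: 0;2;2;5;7;3;3;0]; [:: 0;0;1;1;3;7;5;4]; [:: 3;6;6;7;5;4;7;5];
  [:: 3;6;6;7;5;5;4;4]; [:: 3;4;6;5;7;3;5;7]; [:: 2;4;6;5;5;7;7;6];
  [:: 3;5;4;6;7;7;5;3]; [:: 1;3;5;7;7;6;6;5]; [:: 3;5;4;6;5;4;7;7];
  [:: 3;1;5;6;6;5;7;7]; [:: 3;6;6;7;4;4;5;5]; [:: 3;7;6;2;4;6;5;5];
  [:: 0;3;7;6;5;4;6;5]; [:: 3;5;4;6;6;7;7;4]; [:: 3;6;6;7;5;5;7;4];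
  [:: 0;3;7;6;5;7;6;4]; [:: 1;6;4;3;6;4;7;5]; [:: 3;4;6;5;7;3;5;6];
  [:: 3;4;6;5;7;7;5;3]; [:: 3;4;6;5;7;7;5;6]; [:: 2;6;4;3;6;7;7;5];
  [:: 3;5;4;6;7;7;6;3]; [:: 3;5;4;6;5;7;7;3]; [:: 3;4;6;5;4;7;5;6];
  [:: 0;5;5;7;6;3;4;4]; [:: 3;5;4;6;6;7;5;3]; [:: 0;3;7;6;6;7;4;4];
  [:: 1;3;5;7;7;6;4;4]; [:: 3;5;4;6;6;3;5;7]; [:: 3;6;6;7;5;5;4;0];
  [:: 0;3;7;5;4;6;5;4]; [:: 3;1;5;6;6;7;7;3]; [:: 3;0;5;6;4;4;6;5];
  [:: 3;7;6;2;4;3;5;6]; [:: 3;6;6;7;4;4;7;5]; [:: 0;3;7;6;5;7;4;4];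
  [:: 0;3;7;6;6;7;5;4]; [:: 1;3;5;7;7;6;4;5]; [:: 3;6;6;7;4;5;5;4];
  [:: 3;5;4;6;6;7;5;4]; [:: 3;4;6;5;7;7;4;3]; [:: 3;4;6;5;4;7;5;0];
  [:: 3;5;4;6;5;7;7;4]; [:: 3;5;4;6;7;7;5;4]; [:: 2;4;6;5;5;7;7;3];
  [:: 0;5;5;7;6;4;4;3]; [:: 3;0;5;6;7;5;4;4]; [:: 3;5;4;6;7;3;5;7];
  [:: 3;5;4;6;7;3;6;7]; [:: 3;5;4;6;6;7;7;3]; [:: 3;5;4;6;7;4;5;7];
  [:: 2;6;4;3;5;7;6;5]; [:: 1;3;5;7;4;5;6;6]; [:: 3;7;6;2;4;6;7;5];
  [:: 3;7;6;2;4;3;7;6]; [:: 0;5;5;7;4;6;7;4]; [:: 2;6;4;3;3;7;5;5];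
  [:: 1;3;5;7;4;5;7;6]; [:: 0;3;7;6;6;5;4;4]; [:: 2;4;6;5;5;3;7;6];
  [:: 3;0;5;6;4;7;6;4]; [:: 2;4;6;5;7;7;5;6]].

Definition C6_to_C8_refutation : seq token := [::
  B 0 5; B 5 0; B 1 4; B 6 1; U; U; U; F 6 4; U; U; U; F 6 2; F 6 3; U; B 1 6;
  U; U; U; F 4 6; U; U; U; F 3 6; F 4 6; F 5 6; U; F 3 1; B 4 0; B 7 2; U; U;
  U; F 5 3; F 6 3; F 6 4; F 6 5; U; F 2 0; U; B 3 2; B 1 6; U; U; F 1 7; F 3 7;
  U; U; U; U; F 2 6; F 3 6; U; U; U; U; F 5 3; F 6 3; F 6 4; F 6 5; U; F 2 0;
  F 4 2; U; F 4 1; U; B 5 1; B 3 3; U; U; U; U; F 4 3; F 5 4; U; F 6 4; F 6 5;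
  F 7 3; B 1 6; U; F 5 6; F 5 6; U; F 7 6; B 3 5; U; U; U; F 1 3; U; F 1 2;
  F 4 5; U; B 1 4; U; U; U; F 6 5; F 7 5; U; F 6 3; F 6 4; U; B 4 3; U; U; U;
  F 2 0; U; F 5 4; U; F 2 0; B 6 2; U; U; U; F 4 3; F 4 4; F 4 5; U; U; F 2 4;
  B 5 2; U; U; U; F 4 3; F 4 4; U; U; F 1 2; B 4 2; U; U; U; F 5 3; F 5 4;
  F 6 3; F 6 4; F 6 5; F 7 3; F 7 4; B 1 6; U; F 4 1; F 4 6; U; U; F 5 6;
  F 7 6; U; B 5 7; B 1 7; U; U; F 4 4; F 6 4; U; F 6 7; B 5 6; B 1 6; U; U;
  F 4 4; U; F 6 3; U; F 4 6; B 1 2; B 4 1; U; U; F 5 4; U; F 6 3; F 6 4; F 6 5;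
  F 7 3; F 7 4; U; F 7 6; B 6 7; B 6 6; B 7 4; B 1 3; U; U; F 4 3; F 5 3;
  F 6 3; U; F 4 4; F 5 4; U; F 2 5; F 6 5; U; B 7 3; B 5 4; U; U; U; F 4 3;
  F 4 4; F 5 5; F 6 3; U; U; F 6 4; U; F 7 6; U; U; F 4 3; U; F 4 4; F 5 5;
  F 6 3; U; U; F 4 4; F 5 4; F 6 4; B 1 3; U; F 4 3; F 5 3; F 7 3; U; F 1 5;
  F 7 5; U; U; F 4 3; F 5 5; F 6 3; U; U; F 4 6; F 4 7; F 7 6; F 7 7; B 4 4; U;
  U; F 1 3; F 4 3; F 5 3; F 6 3; U; F 1 5; F 1 4; F 6 4; F 7 4; U; U; F 7 3; U;
  F 4 6; F 4 7; F 7 6; F 7 7; B 4 4; U; U; F 1 3; F 5 3; F 6 3; U; F 5 5;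
  F 7 4; U; F 1 4; F 6 4; F 7 4; U; U; F 7 3; U; F 4 6; F 4 7; F 6 6; F 6 7;
  F 7 6; F 7 7; B 4 4; U; U; F 1 3; F 4 3; F 5 3; F 6 3; U; F 1 4; F 1 4;
  F 6 4; F 7 4; U; U; F 7 3; U; F 4 6; F 6 6; F 7 6; B 4 4; U; F 1 2; F 4 7;
  F 6 7; F 7 7; U; F 1 3; F 5 3; F 6 3; U; F 1 4; F 6 4; F 7 4; U; F 1 4; U; U;
  F 7 3; U; F 4 7; F 6 7; B 4 4; U; F 1 2; B 1 6; U; F 5 6; F 6 6; U; F 5 3; U;
  F 6 6; F 7 6; U; F 1 3; F 5 3; F 6 3; U; F 2 4; F 5 4; U; F 6 4; F 7 4; U;
  F 1 4; U; U; F 7 3; B 5 0; B 1 6; B 0 3; U; U; U; F 3 7; F 4 7; U; F 4 1; U;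
  U; U; F 3 3; U; B 0 4; B 1 3; B 4 2; U; U; U; F 2 5; F 4 5; U; B 6 1; U; U;
  U; F 7 1; F 7 2; U; F 3 2; F 4 1; U; F 2 5; F 4 5; U; U; U; U; F 6 2; U;
  F 3 2; F 5 2; U; F 2 5; F 4 5; U; U; U; U; F 3 5; F 3 6; F 3 7; F 4 5; F 4 7;
  F 5 6; U; F 5 2; B 1 5; U; U; U; F 3 6; F 3 7; F 4 7; F 5 6; F 5 7; U; F 3 2;
  B 4 3; B 2 3; U; U; F 4 5; F 4 7; F 5 7; U; F 2 6; B 4 2; U; U; U; F 3 5;
  F 3 7; U; F 4 7; B 6 6; B 6 2; U; U; U; F 3 3; F 3 5; U; F 6 3; B 4 6; B 3 1;
  U; U; F 3 5; F 3 7; U; F 4 5; B 3 6; B 5 6; B 6 4; B 3 4; B 4 7; U; U; U;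
  F 3 5; F 4 4; F 6 5; U; U; U; F 3 5; F 4 4; F 6 5; U; U; U; F 3 3; F 3 5;
  F 4 5; F 5 3; F 5 7; F 6 7; U; U; U; F 3 3; F 3 5; F 4 5; F 5 3; F 5 7;
  F 6 7; U; U; U; F 3 4; F 4 4; F 4 5; F 5 5; F 5 7; F 6 7; U; U; U; F 3 3;
  F 3 5; F 4 5; F 5 3; F 5 7; F 6 7; U; U; U; F 4 5; F 4 7; F 6 4; F 6 5;
  B 3 1; U; F 3 5; U; F 3 4; F 5 7; U; U; U; F 6 3; F 6 4; F 6 5; B 3 5; U;
  F 4 5; F 4 7; U; F 3 4; F 5 7; U; F 3 3; F 3 7; U; F 4 7; U; F 4 1; B 3 3;
  B 3 1; U; U; U; F 4 5; F 4 7; U; F 3 5; U; U; U; F 3 4; F 3 5; F 3 6; F 3 7;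
  F 5 5; F 5 7; U; F 0 1; F 1 2; U; F 4 4; F 4 5; B 6 2; U; F 6 5; F 6 6;
  F 6 7; U; B 1 4; U; U; F 3 5; F 3 7; U; F 4 5; F 4 7; U; F 0 3; F 1 3; F 5 7;
  B 6 1; U; F 6 4; U; F 6 2; F 6 3; U; B 2 6; B 3 4; U; U; U; F 0 1; U; F 4 5;
  U; F 0 1; B 0 3; B 4 2; U; U; F 3 5; F 4 5; U; B 5 1; U; F 3 7; F 4 7; U;
  B 5 2; U; F 3 7; F 4 7; U; B 6 3; U; F 7 1; U; U; F 1 3; B 0 1; B 3 4; B 6 6;
  B 3 6; B 6 0; B 5 6; B 7 2; U; U; U; F 3 7; F 7 7; U; B 7 6; B 4 4; B 4 5; U;
  U; U; F 5 5; F 5 7; F 6 7; U; U; F 3 5; F 5 4; U; F 5 7; F 6 7; F 7 4; F 7 5;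
  U; U; F 3 5; F 5 4; F 5 7; F 6 7; F 7 4; F 7 5; U; U; U; F 3 5; F 5 4; F 5 7;
  F 6 7; U; F 7 4; F 7 5; U; U; U; F 4 4; F 4 5; U; F 5 5; F 5 7; F 6 7; U; U;
  F 7 1; U; U; F 3 1; F 3 7; F 4 7; U; U; U; U; F 3 5; F 3 7; F 4 5; F 4 7;
  F 5 4; F 5 7; F 6 5; F 6 7; U; F 4 6; U; F 4 5; F 4 7; F 5 7; U; F 6 4; U;
  F 6 5; U; F 3 6; F 4 5; F 5 5; F 5 7; F 6 6; F 6 7; U; F 3 4; U; F 3 6;
  F 4 4; F 4 5; F 5 5; F 5 7; F 6 6; F 6 7; U; U; F 3 4; F 3 5; F 3 6; F 3 7;
  F 4 4; F 4 5; F 4 7; U; U; F 1 2; F 5 5; F 5 7; B 6 2; U; F 6 5; U; F 6 6;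
  F 6 7; U; B 1 6; B 7 1; U; U; F 5 7; U; F 6 7; F 7 7; U; F 6 2; B 6 1; B 3 0;
  U; U; F 3 7; F 5 7; U; U; U; U; F 3 7; U; F 5 7; F 6 7; U; F 5 2; B 7 7;
  B 6 7; B 5 1; U; F 6 5; U; F 6 6; F 7 5; B 3 0; U; F 0 1; F 3 1; U; F 3 2;
  B 0 3; U; F 7 3; U; U; F 2 3; U; U; U; U; F 2 7; F 3 7; U; B 5 7; B 4 0;
  B 1 4; B 3 1; U; U; F 2 7; U; F 2 5; U; U; U; F 2 3; U; U; F 5 4; F 5 5;
  F 6 4; F 6 5; F 6 6; U; F 0 4; U; U; U; U; F 1 7; U; F 7 3; F 7 5; U; B 4 1;
  U; U; F 5 6; F 6 5; F 6 6; F 7 5; F 7 6; B 0 3; U; F 0 1; F 2 3; U; F 5 2; U;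
  U; F 5 3; U; B 4 7; B 5 2; B 4 5; U; U; F 6 5; F 6 6; F 7 6; B 0 3; U; F 5 3;
  F 5 3; U; U; F 2 0; F 6 6; F 7 6; U; F 6 2; B 0 1; B 4 2; U; U; F 2 0; F 6 5;
  F 6 6; F 7 5; F 7 6; B 0 3; U; F 7 3; U; U; F 5 3; U; B 7 6; B 0 3; U; F 5 3;
  F 6 3; U; F 5 6; B 7 3; B 7 5; B 4 5; U; U; U; U; F 4 3; F 4 6; F 6 3; F 6 4;
  F 7 4; U; U; U; U; F 5 3; F 6 5; F 6 6; U; F 5 3; U; F 6 5; F 6 6; U; U;
  F 5 3; F 6 5; F 6 6; U; U; F 4 5; F 5 6; F 6 5; F 6 6; B 0 3; U; F 5 3;
  F 5 3; U; U; F 4 5; F 6 5; F 6 6; F 7 5; F 7 6; U; F 2 0; B 0 3; U; F 6 3; U;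
  F 5 3; U; U; F 5 5; F 6 5; F 6 6; F 7 5; F 7 6; U; F 2 0; B 0 3; U; F 6 3;
  F 5 3; U; U; F 6 5; F 6 6; F 7 5; F 7 6; U; F 2 0; U; F 0 1; B 4 2; U; F 4 0;
  F 4 1; B 0 3; U; U; F 7 3; U; U; F 2 3; U; F 4 5; F 4 6; B 0 3; U; F 6 3; U;
  F 4 3; F 6 3; F 6 4; F 7 4; U; U; F 5 5; F 5 6; U; F 2 0; F 7 5; F 7 6; U;
  F 0 1; B 4 0; U; U; F 3 1; F 3 2; B 0 3; U; F 7 3; U; U; F 2 3; U; F 4 5;
  F 4 6; U; F 5 7; B 0 3; U; F 5 3; F 5 3; U; U; F 5 5; F 5 6; U; F 2 0; F 6 5;
  F 6 6; U; F 0 1; B 4 0; U; U; F 3 1; F 3 2; B 0 3; U; F 6 3; U; U; F 2 3; U;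
  F 4 5; F 4 7; U; F 5 7; B 0 3; U; F 5 3; F 5 3; U; B 5 5; B 5 1; B 2 0;
  B 3 5; B 0 4; U; U; U; F 6 2; F 6 3; U; B 3 4; B 6 5; B 7 5; B 1 2; B 7 4;
  B 4 5; B 4 4; B 5 4; B 6 4; B 6 7; B 3 7; B 5 7; B 5 3; U; U; U; F 3 6;
  F 6 6; U; B 3 6; U; F 1 3; F 2 3; F 7 7; U; U; F 5 6; U; F 0 3; F 1 3; F 7 7;
  U; U; F 4 6; F 5 6; U; U; F 3 6; F 4 6; F 5 6; F 6 6; B 0 3; U; U; F 3 3; U;
  F 5 3; F 7 3; U; U; F 3 6; F 4 6; F 5 6; F 6 6; B 0 3; U; U; F 3 3; F 5 3;
  F 7 3; U; U; F 3 6; F 4 6; F 5 6; B 0 3; U; U; F 3 7; F 7 7; U; F 5 3; F 7 3;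
  U; U; U; U; F 3 6; F 5 7; F 6 6; F 6 7; U; U; U; F 3 6; F 5 7; F 6 6; F 6 7;
  U; U; U; F 3 7; F 5 6; F 6 6; F 7 7; U; U; U; U; F 3 6; F 5 4; F 5 7; F 6 6;
  F 6 7; U; U; U; U; F 3 7; F 5 6; F 6 6; F 7 7; U; U; U; U; F 3 6; F 5 4;
  F 5 7; F 6 6; F 6 7; F 7 4; U; U; U; U; F 3 6; F 4 4; F 4 7; F 5 4; F 6 6;
  F 6 7; U; U; U; U; F 3 6; F 4 4; F 4 7; F 5 4; F 6 6; F 6 7; U; U; F 3 7; U;
  F 5 6; F 6 5; F 6 6; F 7 5; F 7 7; U; B 3 4; B 3 0; U; F 3 6; F 3 7; U;
  F 5 7; U; U; U; F 3 6; F 3 7; F 4 4; F 5 6; F 5 7; F 6 6; F 6 7; F 7 4;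
  F 7 7; B 0 3; U; F 3 3; U; F 3 3; F 7 3; U; U; F 0 4; F 1 4; F 2 4; U; F 5 6;
  B 4 6; B 3 0; U; U; F 6 2; F 6 3; U; U; U; U; F 6 2; F 6 3; U; U; F 4 2;
  F 4 3; U; U; F 5 6; F 5 7; F 6 5; F 6 6; F 7 5; F 7 7; B 3 6; U; F 3 7; U;
  F 3 0; B 0 3; U; F 2 3; F 5 3; U; U; F 1 4; F 3 4; U; B 0 1; B 5 2; B 2 0;
  B 3 5; B 0 4; U; U; U; F 4 4; B 5 4; B 4 4; B 7 4; B 6 4; B 6 5; B 3 4;
  B 7 5; B 4 5; B 4 7; B 7 7; B 4 3; U; U; F 3 6; F 5 7; F 6 6; F 6 7; U;
  B 2 3; B 6 2; B 5 6; B 3 6; U; F 3 7; F 4 6; U; U; F 3 7; F 4 6; U; U; F 3 6;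
  F 5 7; U; U; F 6 6; F 6 7; U; U; U; U; F 7 2; U; F 3 6; F 5 7; F 6 6; F 6 7;
  U; U; F 3 6; F 5 6; F 6 6; B 0 3; U; F 5 3; U; F 5 3; F 7 3; U; U; F 3 6;
  F 5 6; F 6 6; B 0 3; U; U; F 5 7; F 6 7; U; F 5 3; F 7 3; U; U; F 3 6; F 5 7;
  F 6 6; F 6 7; U; U; F 3 6; F 4 7; F 6 6; F 6 7; U; U; F 3 6; F 5 7; F 6 6;
  F 6 7; F 7 5; U; U; F 3 6; F 4 7; F 6 6; F 6 7; U; U; F 3 6; F 5 7; F 6 6;
  F 6 7; F 7 5; U; U; F 3 6; F 4 7; F 6 6; F 6 7; U; U; F 3 6; F 3 7; F 4 5;
  F 4 6; F 4 7; F 5 6; F 6 6; F 6 7; U; F 7 2; U; F 3 6; F 3 7; F 4 5; F 4 6;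
  F 5 6; F 5 7; F 6 6; F 6 7; U; F 3 4; F 4 4; U; B 5 3; U; F 3 3; F 3 4;
  F 3 6; F 3 7; U; F 4 3; F 4 4; F 5 6; F 5 7; F 6 6; F 6 7; U; U; F 7 2;
  B 1 3; B 3 3; U; F 0 3; U; U; F 0 3; F 5 7; F 6 6; F 6 7; F 7 5; B 2 4; U;
  F 0 4; F 1 4; B 3 0; U; F 6 2; F 6 3; U; F 6 4; F 7 4; U; F 7 2; F 3 4;
  F 5 4; F 7 4; U; F 3 6; U; F 3 0; F 3 1; F 3 3; F 5 6; U; F 3 6; U; F 5 6;
  F 5 7; F 6 6; F 6 7; F 7 5; B 3 7; U; F 3 5; F 3 6; F 4 6; B 0 3; U; F 5 3;
  U; F 5 4; F 7 4; U; F 3 0; F 3 1; B 0 3; U; F 5 3; U; F 1 4; F 3 4; U; B 1 2;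
  B 5 6; B 2 6; B 3 5; B 4 3; B 3 6; B 4 4; B 3 7; B 3 3; B 5 7; U; U; F 6 6;
  F 6 7; F 7 5; B 0 3; U; F 1 3; F 6 3; U; U; F 5 4; F 7 4; U; U; F 4 7; F 6 6;
  U; F 6 7; F 7 5; U; F 7 4; U; U; F 5 3; U; F 4 5; F 4 7; F 5 7; F 6 6; F 6 7;
  U; F 5 4; U; F 4 5; U; F 4 7; F 5 7; F 6 6; F 6 7; U; F 5 4; U; U; F 5 4;
  F 7 4; U; F 5 7; F 6 6; F 6 7; F 7 5; U; U; U; F 4 6; F 5 7; F 6 5; F 6 7;
  F 7 5; F 7 7; U; F 5 3; U; U; F 5 3; F 7 3; U; F 5 7; F 6 5; F 7 5; F 7 6;
  F 7 7; U; F 6 4; U; B 3 0; B 3 4; U; B 7 6; B 4 0; U; U; F 0 4; U; U; F 4 3;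
  B 4 6; B 5 3; B 5 4; B 6 5; B 6 4; U; U; U; F 5 7; F 7 7; U; U; U; F 4 3;
  F 6 3; F 6 7; F 7 5; F 7 7; U; U; U; F 4 3; F 6 3; F 6 7; F 7 5; F 7 7; U; U;
  F 4 3; F 6 3; F 6 7; F 7 5; F 7 7; U; U; F 7 3; U; F 5 4; F 5 7; F 6 4;
  F 6 5; F 7 7; U; U; F 5 4; F 5 7; F 6 4; F 6 5; F 7 7; U; U; F 5 4; F 5 7;
  F 6 4; F 6 5; U; F 7 5; F 7 7; U; U; F 4 6; F 5 7; F 6 5; F 6 6; F 7 5;
  F 7 6; F 7 7; B 0 3; U; F 1 3; F 6 3; U; U; F 5 4; F 6 4; U; B 2 0; B 5 7;
  B 7 5; B 7 7; B 7 6; B 3 0; B 3 3; B 4 6; B 4 7; B 6 6; B 4 1; U; F 3 5;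
  F 3 7; U; F 3 2; B 4 3; B 4 4; B 6 4; B 6 5; U; F 3 5; F 3 6; B 4 5; U;
  F 7 3; F 5 4; F 6 7; F 7 4; U; U; F 4 5; F 5 3; F 6 7; U; F 3 4; F 3 6; U; U;
  F 4 5; F 5 3; F 6 7; U; F 3 4; F 3 6; U; U; F 4 5; F 5 3; F 6 4; F 6 5; U;
  F 3 4; U; F 4 5; F 5 3; F 6 4; F 6 5; U; F 3 4; U; F 5 3; F 6 4; F 6 5; U;
  F 3 1; F 3 5; F 3 7; U; F 4 5; U; F 4 3; F 4 5; U; F 5 3; F 6 4; F 6 5; U;
  F 3 4; U; F 4 3; U; F 5 3; F 5 4; F 6 4; F 6 5; F 6 6; F 6 7; F 7 4; U;
  F 3 5; F 3 6; U; B 2 5; U; F 1 3; F 2 3; U; F 5 3; B 1 5; U; F 0 3; F 1 3;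
  F 2 3; U; F 3 1; B 3 5; B 3 7; B 3 6; B 3 2; B 1 4; U; F 1 3; F 2 3; U;
  F 5 3; F 5 4; F 7 3; F 7 4; U; F 0 3; B 2 4; U; F 1 3; F 2 3; U; F 5 3;
  F 5 4; U; B 4 5; B 3 4; B 4 6; U; F 5 4; U; F 5 4; F 6 6; F 6 7; F 7 4; U; U;
  F 1 3; F 2 3; U; F 5 4; F 6 6; F 6 7; F 7 4; U; U; F 4 6; U; F 5 4; F 6 6;
  F 6 7; F 7 4; U; U; F 5 3; F 7 3; B 0 3; B 4 2; U; F 4 0; F 4 1; U; U; F 4 3;
  B 3 4; B 4 5; U; F 5 4; F 6 6; F 6 7; F 7 4; U; U; F 5 4; F 6 6; F 6 7;
  F 7 4; U; U; F 5 4; F 7 4; U; F 6 6; F 6 7; U; U; F 5 4; F 6 6; F 6 7; F 7 4;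
  U; U; F 1 3; F 2 3; U; F 5 3; F 6 3; F 6 5; F 7 3; B 0 4; U; F 6 4; F 3 4;
  F 6 4; U; U; F 1 3; F 2 3; U; F 5 3; F 6 3; F 6 6; F 6 7; B 0 4; U; F 6 4;
  F 5 4; F 7 4; U; F 3 6; U; F 1 3; F 2 3; U; F 5 3; F 6 3; F 6 5; F 7 3;
  B 0 4; U; F 6 4; F 3 4; F 5 4; F 6 4; U; F 3 7; B 6 7; B 6 6; B 6 5; B 3 4;
  B 3 6; U; F 3 1; F 4 2; F 4 4; U; F 4 6; U; F 4 5; B 3 1; U; F 3 5; F 3 7;
  F 5 4; F 7 4; U; F 3 2; F 4 1; U; F 4 6; B 2 4; B 7 4; B 0 3; U; F 1 3;
  F 5 3; F 6 3; U; F 6 4; U; F 1 3; F 5 3; F 5 4; U; U; F 0 4; F 1 4; F 5 4;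
  F 6 4; U; U; F 5 3; F 4 4; U; F 6 4; F 7 4; U; F 0 4; F 1 4; U; U; F 7 3; U;
  F 5 4; F 6 4; F 7 4; B 3 5; B 0 4; U; U; F 1 3; F 3 3; F 4 3; U; F 6 3; U;
  F 1 5; F 2 5; U; F 1 4; F 2 4; U; F 0 4; U; U; F 4 2; F 4 3; U; U; F 3 5;
  F 3 7; F 4 5; F 4 6; B 3 3; U; F 0 3; F 4 2; F 4 3; U; F 5 3; F 6 3; U; U;
  F 3 5; F 3 7; F 4 5; F 4 6; B 3 3; U; F 0 3; F 4 2; F 4 3; U; F 5 3; F 7 3;
  U; U; F 3 5; F 3 7; F 4 5; F 4 6; B 3 3; U; F 0 3; F 4 2; F 4 3; U; F 5 3;
  F 7 3; U; U; F 6 5; B 3 0; B 5 3; B 5 4; B 3 4; U; F 6 4; U; F 1 3; F 2 3;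
  F 3 1; F 3 2; U; B 3 5; B 1 3; U; F 3 1; F 3 2; F 6 3; F 6 4; U; F 2 3; U;
  F 7 3; B 4 1; U; F 4 2; F 4 3; U; F 0 4; F 4 5; F 4 6; U; F 0 4; F 2 4;
  F 7 4; U; F 1 4; F 3 2; U; F 0 4; F 0 4; F 1 4; U; F 3 2; F 0 3; F 1 3;
  F 2 3; U; F 3 1; F 3 5; F 3 6; F 3 7; U; F 4 5; F 4 6; B 3 4; U; F 2 4;
  F 3 1; U; F 0 4; F 1 4; F 2 4; F 6 4; F 7 4; U; U; F 3 1; U; F 6 5; F 6 6;
  B 3 0; B 6 3; B 5 4; B 6 4; B 2 5; U; F 3 4; U; B 0 4; U; U; F 1 4; F 7 4;
  B 4 7; B 3 7; U; F 4 4; F 4 5; F 4 6; B 1 4; U; F 3 5; F 3 6; F 6 7; U; U;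
  F 7 6; U; F 3 1; F 3 4; F 3 6; U; F 3 1; F 3 4; U; F 3 5; F 3 6; U; F 4 0;
  F 4 6; U; F 4 0; F 4 1; F 4 2; F 4 4; U; F 4 5; F 4 6; U; F 3 6; F 0 4;
  F 1 4; F 2 4; U; U; F 5 3; F 0 4; F 1 4; U; U; F 3 2; F 0 3; F 1 3; F 2 3; U;
  F 3 1; F 3 6; F 3 7; U; F 4 5; F 4 7; B 3 4; U; F 0 4; F 2 4; F 4 4; U;
  F 6 7; F 0 4; F 1 4; F 2 4; F 5 4; F 6 4; F 7 4; U; U; F 3 1; U; F 6 6;
  F 6 7; B 3 0; B 6 4; B 6 3; B 0 4; U; U; F 1 4; F 5 4; B 1 4; U; F 3 1;
  F 3 5; F 3 7; U; F 3 3; U; U; F 7 4; F 7 7; B 2 4; U; F 3 1; F 3 3; U; B 4 6;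
  B 3 6; U; F 4 4; F 4 5; F 4 7; U; F 3 5; F 3 1; F 3 5; U; F 3 7; U; F 4 0;
  F 4 7; U; F 4 2; F 4 5; U; F 4 7; F 3 7; U; F 0 3; F 1 3; F 2 3; U; F 3 1;
  F 0 4; F 1 4; U; F 3 2; F 3 6; F 3 7; U; F 4 5; F 4 7; B 3 4; U; F 5 4;
  F 0 4; F 1 4; F 2 4; F 5 4; F 6 4; F 7 4; U; U; F 3 1; U; F 6 5; F 6 6;
  F 7 5; F 7 6; B 3 0; B 7 4; B 7 3; B 0 4; U; U; F 1 3; F 6 4; B 1 4; U; U;
  F 3 3; U; F 5 4; B 3 5; B 4 1; U; F 4 0; F 4 2; F 4 4; F 4 6; F 4 7; U;
  F 3 6; F 4 4; F 4 5; F 4 6; F 4 7; U; F 6 7; F 7 7; U; F 3 6; F 3 4; F 3 6;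
  U; F 0 3; F 3 3; U; F 0 3; F 1 3; F 2 3; U; F 3 1; F 0 4; F 1 4; U; F 3 2;
  F 3 5; F 3 6; U; F 4 5; F 4 6; F 4 7; B 0 4; B 3 3; U; U; F 6 7; F 7 7; U;
  F 7 3; F 7 3; U; U; F 4 4; F 4 4; F 7 4; U; F 3 1; F 4 2; U; U; F 5 7; F 6 5;
  F 6 6; F 6 7; F 7 5; F 7 6; F 7 7; B 0 3; B 4 6; B 4 7; B 3 7; B 3 1; U;
  F 4 3; F 3 5; B 3 3; U; F 4 5; U; F 6 3; F 5 3; F 6 3; F 7 3; U; F 4 2;
  F 4 3; U; F 3 1; F 3 2; U; F 7 3; U; F 1 3; F 2 3; U; F 4 1; F 4 2; U; F 7 3;
  U; F 1 3; F 2 3; F 4 0; U; F 4 1; F 4 2; U; F 7 3; U; F 1 3; F 2 3; F 4 0; U;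
  F 5 3; U; F 5 4; F 6 4; F 7 3; F 7 4; B 3 5; U; F 3 1; U; F 3 0; F 3 3;
  F 3 4; U; F 3 0; F 3 1; F 3 2; B 1 3; U; F 2 3; U; F 3 4; F 3 7; U; U; F 6 5;
  F 6 7; F 7 5; F 7 7; B 3 0; B 7 3; B 2 5; U; U; F 5 7; F 6 4; U; B 1 5; U; U;
  U; F 2 6; F 3 2; F 3 6; U; B 7 4; B 1 4; U; U; F 3 3; U; F 5 4; F 6 4; B 0 4;
  U; U; F 1 3; F 5 7; B 3 5; B 4 1; U; F 4 0; F 4 2; F 4 4; F 4 6; F 4 7; U;
  F 3 6; F 4 5; F 4 6; U; F 6 6; U; F 3 4; F 3 1; F 3 4; F 3 7; U; F 5 3;
  F 0 4; F 1 4; U; F 3 2; F 0 3; F 1 3; U; F 3 1; F 3 2; F 3 5; U; F 2 3;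
  F 3 5; F 3 6; F 3 7; U; F 4 5; F 4 6; B 0 4; B 3 3; U; U; F 6 6; F 7 6; U;
  F 7 3; F 1 3; F 6 3; F 7 3; U; F 3 1; U; F 3 4; F 7 4; U; F 3 1; F 4 2; U; U;
  F 5 6; F 5 7; F 6 5; F 6 6; F 6 7; F 7 5; F 7 6; F 7 7; B 3 0; B 3 3; U;
  F 5 3; F 5 4; F 6 4; F 7 4; U; F 3 5; F 3 6; U; B 2 6; U; U; F 6 3; F 7 3; U;
  F 6 4; U; B 3 5; B 0 4; B 1 4; U; F 6 3; F 6 4; U; U; F 6 3; F 6 4; F 7 3;
  F 7 4; U; U; F 5 4; F 7 4; U; F 1 3; F 2 3; F 3 1; F 3 2; U; U; F 1 3; F 2 3;
  F 3 1; F 3 2; U; F 3 5; F 3 7; U; F 4 5; F 4 6; B 3 3; U; F 0 3; F 4 2;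
  F 4 3; U; F 5 3; F 6 3; U; U; F 5 6; F 5 7; F 6 6; F 6 7; F 7 6; F 7 7;
  B 7 5; B 6 5; B 5 2; U; F 2 0; B 3 5; U; F 3 6; F 3 7; F 4 6; B 0 3; U;
  F 5 3; U; F 5 4; F 7 4; U; U; F 3 0; F 3 1; B 0 3; U; F 5 3; U; F 1 4; F 3 4;
  U; B 0 3; B 4 7; B 2 7; U; U; U; F 1 3; F 6 3; U; F 2 0; B 3 5; B 4 5; B 4 2;
  U; F 1 3; F 2 3; F 4 6; F 5 3; U; F 3 3; F 4 6; B 7 3; B 0 4; U; F 4 4; U;
  F 5 4; F 7 4; U; F 3 7; F 1 3; F 4 3; U; F 5 3; F 6 3; U; F 3 7; U; F 4 0;
  F 4 2; U; U; F 2 3; U; F 3 0; F 3 2; U; F 2 3; F 7 3; U; F 1 3; F 3 1; U;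
  F 4 0; F 4 2; U; F 2 5; U; F 3 1; F 3 5; U; U; F 5 3; F 5 4; F 6 3; F 6 4;
  F 7 3; F 7 4; B 2 6; U; B 3 5; U; F 3 0; F 3 2; U; F 3 1; F 3 3; F 3 4; U;
  F 3 0; B 1 3; U; F 2 5; U; F 3 4; F 3 7; U; F 1 5; U; F 2 5; U; F 7 2; F 1 5;
  U; F 2 5; U; F 6 2; U; F 6 6; F 6 7; F 7 6; F 7 7; B 2 6; U; F 0 1; B 4 0; U;
  U; F 3 1; F 4 1; F 4 2; B 0 3; U; F 2 5; F 4 5; U; F 6 3; U; U; F 3 4; U;
  F 4 6; U; F 6 5; F 7 5; B 0 3; U; U; F 1 3; F 6 3; U; F 4 3; F 6 3; U; F 2 0;
  B 3 0; B 5 4; B 5 1; U; F 5 6; F 5 7; U; F 3 7; B 5 2; U; F 5 6; F 5 7; U;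
  F 3 7; U; F 1 2; B 7 4; B 7 3; B 2 4; U; F 3 3; U; F 6 4; B 1 4; U; F 3 3; U;
  F 5 6; F 5 7; B 0 4; U; B 4 5; B 3 5; U; F 4 6; F 7 5; U; F 3 7; F 3 1; U;
  F 3 4; F 3 6; F 3 7; U; F 3 3; B 4 0; U; F 4 6; U; F 4 7; U; F 6 5; F 4 0;
  F 4 1; F 4 2; U; F 4 6; F 4 7; U; F 3 6; F 0 3; F 1 3; F 2 3; U; F 3 1;
  F 0 4; F 1 4; F 2 4; U; U; F 5 3; U; F 1 4; F 2 4; U; F 3 6; F 3 7; U; F 7 1;
  F 3 6; F 3 7; U; F 4 6; F 4 7; B 5 1; B 7 3; U; U; U; F 3 3; F 3 4; U; F 5 6;
  U; U; F 0 3; F 1 3; F 2 3; U; F 4 5; F 6 5; F 7 5; B 0 4; U; F 5 4; U; F 2 4;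
  F 3 4; U; B 6 2; B 0 3; U; U; U; F 3 5; U; F 7 5; U; F 4 3; F 7 3; U; U;
  F 3 5; F 4 5; B 3 3; U; F 0 3; F 4 2; F 4 3; U; F 6 3; F 7 3; U].

Definition segment_paths : seq (seq edge) := map pairs [::
  [:: 0;0;1;4;4;1;2;2;3;3]; [:: 0;4;4;0;1;1;2;2;3;3]; [:: 0;0;1;1;2;2;4;4;3;3];
  [:: 0;0;1;1;2;2;3;4;5;3]; [:: 0;0;1;5;4;1;2;2;3;3]; [:: 0;0;1;1;4;5;2;2;3;3];
  [:: 0;0;1;4;5;1;2;2;3;3]; [:: 0;0;1;1;2;2;4;5;3;3]; [:: 0;0;1;1;4;4;2;2;3;3];
  [:: 0;0;1;1;2;2;4;6;3;3]; [:: 0;0;1;1;2;2;3;5;5;3]; [:: 0;0;1;1;2;2;3;4;4;3];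
  [:: 0;0;1;1;2;2;4;7;3;3]; [:: 0;0;1;1;2;2;3;4;6;3]; [:: 0;0;1;1;2;4;7;2;3;3];
  [:: 0;0;1;1;2;5;4;2;3;3]; [:: 0;0;1;1;5;4;2;2;3;3]; [:: 0;0;1;4;6;1;2;2;3;3];
  [:: 0;0;4;6;1;1;2;2;3;3]; [:: 0;0;1;4;7;1;2;2;3;3]; [:: 0;0;1;1;2;2;3;7;6;3];
  [:: 0;0;1;1;2;4;6;2;3;3]; [:: 0;0;1;5;5;1;2;2;3;3]; [:: 0;0;1;1;2;2;3;6;5;3];
  [:: 0;0;1;1;4;6;2;2;3;3]; [:: 0;0;1;1;2;2;3;6;4;3]; [:: 0;0;1;1;2;7;4;2;3;3];
  [:: 0;0;1;6;4;1;2;2;3;3]; [:: 0;0;4;4;1;1;2;2;3;3]; [:: 0;0;1;1;2;4;5;2;3;3];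
  [:: 0;0;4;7;1;1;2;2;3;3]; [:: 0;0;1;1;2;2;5;6;3;3]; [:: 0;0;1;5;6;1;2;2;3;3];
  [:: 0;0;1;1;4;7;2;2;3;3]; [:: 0;0;1;1;2;4;4;2;3;3]; [:: 0;0;1;6;5;1;2;2;3;3];
  [:: 0;0;1;1;2;2;3;7;5;3]; [:: 0;0;1;1;2;2;3;5;6;3]; [:: 0;0;1;1;2;6;4;2;3;3];
  [:: 0;0;1;1;2;2;3;6;6;3]; [:: 0;0;4;5;1;1;2;2;3;3]; [:: 0;0;1;1;2;2;3;7;4;3];
  [:: 0;5;4;0;1;1;2;2;3;3]; [:: 0;0;1;1;2;5;5;2;3;3]; [:: 0;0;1;1;2;2;5;5;3;3];
  [:: 0;4;6;0;1;1;2;2;3;3]; [:: 0;0;1;1;2;2;3;4;7;3]; [:: 0;0;1;5;7;1;2;2;3;3];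
  [:: 0;0;1;1;2;2;3;5;7;3]; [:: 0;0;1;6;6;1;2;2;3;3]; [:: 0;0;1;1;2;2;6;5;3;3];
  [:: 0;0;1;1;5;6;2;2;3;3]; [:: 0;0;1;1;2;6;6;2;3;3]; [:: 0;0;1;1;2;5;7;2;3;3];
  [:: 0;0;1;1;2;2;3;5;4;3]; [:: 0;0;1;1;5;5;2;2;3;3]; [:: 0;0;1;1;2;6;5;2;3;3];
  [:: 0;0;1;1;2;2;5;4;3;3]; [:: 0;0;5;7;1;1;2;2;3;3]; [:: 0;0;1;1;2;2;6;6;3;3];
  [:: 0;0;1;7;5;1;2;2;3;3]; [:: 0;0;1;1;2;2;3;7;7;3]; [:: 0;0;1;1;6;4;2;2;3;3];
  [:: 0;5;5;0;1;1;2;2;3;3]; [:: 0;4;5;0;1;1;2;2;3;3]; [:: 0;6;4;0;1;1;2;2;3;3];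
  [:: 0;0;5;6;1;1;2;2;3;3]; [:: 0;0;1;1;7;4;2;2;3;3]; [:: 0;0;1;1;2;7;5;2;3;3];
  [:: 0;0;5;5;1;1;2;2;3;3]; [:: 0;0;6;4;1;1;2;2;3;3]; [:: 0;0;1;1;6;6;2;2;3;3];
  [:: 0;0;1;6;7;1;2;2;3;3]; [:: 0;0;1;1;2;2;6;7;3;3]; [:: 0;6;6;0;1;1;2;2;3;3];
  [:: 0;5;6;0;1;1;2;2;3;3]; [:: 0;0;1;1;2;2;6;4;3;3]; [:: 0;0;1;1;2;5;6;2;3;3];
  [:: 0;6;5;0;1;1;2;2;3;3]; [:: 0;0;1;1;2;7;6;2;3;3]; [:: 0;0;1;1;6;5;2;2;3;3];
  [:: 0;0;5;4;1;1;2;2;3;3]; [:: 0;0;6;6;1;1;2;2;3;3]; [:: 0;0;1;7;4;1;2;2;3;3];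
  [:: 0;0;1;1;2;6;7;2;3;3]; [:: 0;0;1;1;2;2;5;7;3;3]; [:: 0;0;6;7;1;1;2;2;3;3];
  [:: 0;0;6;5;1;1;2;2;3;3]; [:: 0;0;1;1;7;6;2;2;3;3]; [:: 0;0;1;1;5;7;2;2;3;3];
  [:: 0;0;1;1;6;7;2;2;3;3]; [:: 0;0;1;1;7;7;2;2;3;3]; [:: 0;0;1;7;7;1;2;2;3;3];
  [:: 0;4;1;0;4;1;2;2;3;3]; [:: 0;4;2;1;1;0;4;2;3;3]; [:: 0;5;7;4;1;1;2;2;3;3];
  [:: 0;4;3;2;2;1;1;0;4;3]; [:: 0;0;1;4;3;2;2;1;4;3]; [:: 0;5;5;2;2;1;1;0;3;3];
  [:: 0;0;1;1;2;2;5;6;6;3]; [:: 0;0;4;1;1;4;2;2;3;3]; [:: 0;0;4;2;2;1;1;4;3;3];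
  [:: 0;5;4;1;1;0;2;2;3;3]; [:: 0;4;6;5;1;1;2;2;3;3]; [:: 0;6;6;4;1;1;2;2;3;3];
  [:: 0;5;6;2;2;1;1;0;3;3]; [:: 0;0;4;2;2;1;1;5;3;3]; [:: 0;0;1;4;3;2;2;1;5;3];
  [:: 0;0;3;2;2;1;1;4;5;3]; [:: 0;5;5;1;1;0;2;2;3;3]; [:: 0;0;1;1;5;6;7;2;3;3];
  [:: 0;0;1;1;2;2;5;6;7;3]; [:: 0;4;4;1;1;0;2;2;3;3]; [:: 0;4;7;6;1;1;2;2;3;3];
  [:: 0;4;5;1;1;0;2;2;3;3]; [:: 0;0;3;2;2;1;1;4;4;3]; [:: 0;0;1;1;2;2;4;7;6;3];
  [:: 0;0;1;5;6;6;2;2;3;3]; [:: 0;0;4;7;6;1;2;2;3;3]; [:: 0;0;1;1;2;4;6;5;3;3];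
  [:: 0;5;7;2;2;1;1;0;3;3]; [:: 0;0;1;4;6;5;2;2;3;3]; [:: 0;0;1;1;4;2;2;5;3;3];
  [:: 0;0;1;1;5;6;4;2;3;3]; [:: 0;0;2;1;1;5;4;2;3;3]; [:: 0;4;5;7;1;1;2;2;3;3];
  [:: 0;0;4;1;1;5;2;2;3;3]; [:: 0;0;1;1;3;2;2;5;6;3]; [:: 0;2;2;1;1;0;4;5;3;3];
  [:: 0;0;4;6;5;1;2;2;3;3]; [:: 0;0;4;1;1;6;2;2;3;3]; [:: 0;0;1;4;7;6;2;2;3;3];
  [:: 0;0;1;1;2;4;6;6;3;3]; [:: 0;4;2;1;1;0;5;2;3;3]; [:: 0;0;1;5;6;4;2;2;3;3];
  [:: 0;0;1;2;2;1;5;6;3;3]; [:: 0;5;5;7;1;1;2;2;3;3]; [:: 0;0;1;1;5;6;6;2;3;3];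
  [:: 0;4;6;2;2;1;1;0;3;3]; [:: 0;0;1;1;5;2;2;4;3;3]; [:: 0;4;3;2;2;1;1;0;5;3];
  [:: 0;6;7;4;1;1;2;2;3;3]; [:: 0;1;1;0;4;5;2;2;3;3]; [:: 0;2;2;1;1;0;4;7;3;3];
  [:: 0;0;1;1;2;2;6;5;7;3]; [:: 0;0;1;5;4;2;2;1;3;3]; [:: 0;0;1;1;2;2;5;5;6;3];
  [:: 0;0;1;1;3;2;2;4;6;3]; [:: 0;0;1;1;2;5;6;4;3;3]; [:: 0;4;6;6;1;1;2;2;3;3];
  [:: 0;0;1;1;4;7;5;2;3;3]; [:: 0;0;1;1;2;2;5;7;4;3]; [:: 0;0;1;1;2;6;7;5;3;3];
  [:: 0;0;1;4;4;2;2;1;3;3]; [:: 0;0;1;1;2;6;6;4;3;3]; [:: 0;5;2;1;1;0;4;2;3;3];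
  [:: 0;0;1;1;2;5;7;6;3;3]; [:: 0;1;1;0;4;4;2;2;3;3]; [:: 0;0;1;1;4;5;5;2;3;3];
  [:: 0;0;3;2;2;1;1;6;5;3]; [:: 0;0;1;1;7;2;2;4;3;3]; [:: 0;0;1;1;2;2;6;5;5;3];
  [:: 0;0;1;2;2;1;4;4;3;3]; [:: 0;5;6;7;1;1;2;2;3;3]; [:: 0;0;1;7;3;2;2;1;4;3];
  [:: 0;0;1;1;3;2;2;7;5;3]; [:: 0;0;5;6;2;1;1;2;3;3]; [:: 0;0;4;1;1;7;2;2;3;3];
  [:: 0;0;1;1;3;2;2;6;5;3]; [:: 0;0;1;1;4;7;6;2;3;3]; [:: 0;1;1;0;4;6;2;2;3;3];
  [:: 0;2;2;1;1;0;4;4;3;3]; [:: 0;2;2;1;1;0;4;6;3;3]; [:: 0;0;1;1;3;2;2;6;4;3];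
  [:: 0;0;1;2;2;1;5;5;3;3]; [:: 0;0;2;1;1;5;5;2;3;3]; [:: 0;4;5;2;2;1;1;0;3;3];
  [:: 0;4;6;7;1;1;2;2;3;3]; [:: 0;0;4;2;2;1;1;6;3;3]; [:: 0;0;1;1;3;2;2;4;5;3];
  [:: 0;0;1;1;3;2;2;4;4;3]; [:: 0;0;5;4;2;1;1;2;3;3]; [:: 0;0;1;5;5;2;2;1;3;3];
  [:: 0;0;1;2;2;1;4;5;3;3]; [:: 0;0;1;1;5;5;4;2;3;3]; [:: 0;0;5;6;7;1;2;2;3;3];
  [:: 0;0;1;1;2;2;7;5;6;3]; [:: 0;4;2;1;1;0;6;2;3;3]; [:: 0;4;1;0;5;1;2;2;3;3];
  [:: 0;1;1;0;5;7;2;2;3;3]; [:: 0;6;4;7;1;1;2;2;3;3]; [:: 0;0;3;2;2;1;1;7;5;3];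
  [:: 0;0;1;1;2;2;4;7;7;3]; [:: 0;0;3;2;2;1;1;5;4;3]; [:: 0;0;2;1;1;4;4;2;3;3];
  [:: 0;0;2;1;1;6;6;2;3;3]; [:: 0;0;1;4;6;2;2;1;3;3]; [:: 0;4;6;1;1;0;2;2;3;3];
  [:: 0;0;1;1;2;2;4;7;5;3]; [:: 0;5;3;2;2;1;1;0;4;3]; [:: 0;6;7;5;1;1;2;2;3;3];
  [:: 0;0;4;4;3;2;2;1;1;3]; [:: 0;4;7;7;1;1;2;2;3;3]; [:: 0;0;4;7;7;1;2;2;3;3];
  [:: 0;0;4;6;3;2;2;1;1;3]; [:: 0;0;4;2;2;1;1;7;3;3]; [:: 0;0;1;4;5;2;2;1;3;3];
  [:: 0;0;1;5;7;4;2;2;3;3]; [:: 0;1;1;0;5;4;2;2;3;3]; [:: 0;1;1;0;5;6;2;2;3;3];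
  [:: 0;0;4;5;5;1;2;2;3;3]; [:: 0;6;2;1;1;0;4;2;3;3]; [:: 0;0;2;1;1;6;4;2;3;3];
  [:: 0;1;1;0;5;5;2;2;3;3]; [:: 0;2;2;1;1;0;5;6;3;3]; [:: 0;0;5;7;2;1;1;2;3;3];
  [:: 0;0;4;5;6;1;2;2;3;3]; [:: 0;1;1;0;6;4;2;2;3;3]; [:: 0;0;1;2;2;1;6;5;3;3];
  [:: 0;0;1;1;2;2;7;6;5;3]; [:: 0;0;1;1;4;7;7;2;3;3]; [:: 0;0;6;6;2;1;1;2;3;3];
  [:: 0;0;1;1;3;2;2;5;4;3]; [:: 0;0;2;1;1;6;7;2;3;3]; [:: 0;0;3;2;2;1;1;6;4;3];
  [:: 0;0;1;1;2;5;6;6;3;3]; [:: 0;0;4;7;5;1;2;2;3;3]; [:: 0;6;7;7;1;1;2;2;3;3];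
  [:: 0;0;2;1;1;4;5;2;3;3]; [:: 0;0;1;1;5;7;6;2;3;3]; [:: 0;0;1;1;2;2;5;7;7;3];
  [:: 0;0;1;1;5;7;7;2;3;3]; [:: 0;0;2;1;1;4;6;2;3;3]; [:: 0;0;1;1;2;2;5;7;6;3];
  [:: 0;0;4;6;6;1;2;2;3;3]; [:: 0;0;1;4;6;6;2;2;3;3]; [:: 0;0;5;5;7;1;2;2;3;3];
  [:: 0;0;4;5;7;1;2;2;3;3]; [:: 0;0;2;1;1;6;5;2;3;3]; [:: 0;6;6;7;1;1;2;2;3;3];
  [:: 0;0;2;1;1;5;6;2;3;3]; [:: 0;5;6;1;1;0;2;2;3;3]; [:: 0;0;4;5;3;2;2;1;1;3];
  [:: 0;0;1;1;5;6;3;2;2;3]; [:: 0;0;3;2;2;1;1;5;6;3]; [:: 0;1;1;0;4;7;2;2;3;3];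
  [:: 0;0;1;2;2;1;4;6;3;3]; [:: 0;0;3;2;2;1;1;6;6;3]; [:: 0;4;7;2;2;1;1;0;3;3];
  [:: 0;0;4;4;6;1;2;2;3;3]; [:: 0;0;1;1;3;2;2;7;4;3]; [:: 0;0;1;1;5;4;4;2;3;3];
  [:: 0;0;1;4;3;2;2;1;7;3]; [:: 0;0;1;2;2;1;4;7;3;3]; [:: 0;2;2;1;1;0;6;6;3;3];
  [:: 0;0;4;6;7;1;2;2;3;3]; [:: 0;0;1;1;4;4;6;2;3;3]; [:: 0;1;1;0;6;5;2;2;3;3];
  [:: 0;0;2;1;1;4;7;2;3;3]; [:: 0;2;2;1;1;0;6;4;3;3]; [:: 0;1;1;0;6;7;2;2;3;3];
  [:: 0;0;1;4;2;1;7;2;3;3]; [:: 0;0;6;7;2;1;1;2;3;3]; [:: 0;4;7;5;2;1;1;2;3;3];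
  [:: 0;6;5;2;2;0;1;1;3;3]; [:: 0;0;1;1;2;4;7;6;5;3]; [:: 0;5;4;2;2;0;1;1;3;3];
  [:: 0;6;4;2;2;0;1;1;3;3]; [:: 0;6;7;5;5;1;2;2;3;3]; [:: 0;2;2;1;1;0;4;6;6;3];
  [:: 0;4;7;6;2;1;1;2;3;3]; [:: 0;4;6;7;2;1;1;2;3;3]; [:: 0;2;2;1;1;0;4;6;5;3];
  [:: 0;6;7;7;4;1;2;2;3;3]; [:: 0;0;1;2;2;1;4;6;6;3]; [:: 0;4;2;2;4;1;1;0;3;3];
  [:: 0;4;5;5;2;1;1;2;3;3]; [:: 0;0;1;1;2;4;7;5;6;3]; [:: 0;0;1;2;2;1;6;5;5;3];
  [:: 0;4;4;2;2;0;1;1;3;3]; [:: 0;4;2;2;3;0;1;1;4;3]; [:: 0;0;1;2;2;1;4;6;5;3];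
  [:: 0;5;6;4;3;2;2;1;1;3]; [:: 0;0;1;1;2;4;7;7;4;3]; [:: 0;4;1;1;2;2;3;0;4;3];
  [:: 0;1;2;2;3;4;1;0;4;3]; [:: 0;4;5;2;2;0;1;1;3;3]; [:: 0;6;5;5;4;1;2;2;3;3];
  [:: 0;2;2;1;1;0;4;6;7;3]; [:: 0;4;6;5;2;1;1;0;3;3]; [:: 0;6;7;7;5;1;2;2;3;3];
  [:: 0;0;1;1;2;4;7;6;4;3]; [:: 0;5;5;7;3;2;2;1;1;3]; [:: 0;4;6;5;2;1;1;2;3;3];
  [:: 0;0;2;2;3;1;1;4;4;3]; [:: 0;0;2;2;3;1;1;5;6;3]; [:: 0;6;7;5;6;1;2;2;3;3];
  [:: 0;6;5;5;7;1;2;2;3;3]; [:: 0;4;6;2;2;0;1;1;3;3]; [:: 0;2;2;1;1;0;6;7;4;3];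
  [:: 0;0;1;1;2;4;7;5;5;3]; [:: 0;6;3;2;2;1;4;0;1;3]; [:: 0;0;1;1;2;4;7;6;6;3];
  [:: 0;4;6;6;2;1;1;2;3;3]; [:: 0;2;2;1;1;0;6;5;4;3]; [:: 0;1;2;2;3;4;1;0;5;3];
  [:: 0;0;2;2;3;1;1;4;5;3]; [:: 0;5;6;6;5;2;2;1;1;3]; [:: 0;2;2;1;1;4;7;7;4;3];
  [:: 0;2;2;1;1;4;5;6;4;3]; [:: 0;5;6;6;4;2;2;1;1;3]; [:: 0;2;2;1;1;4;5;7;6;3];
  [:: 0;2;2;1;1;4;5;6;7;3]; [:: 0;4;5;6;6;7;7;5;3;3]; [:: 0;0;4;7;5;5;7;6;6;3];
  [:: 0;4;5;7;6;5;7;6;3;3]; [:: 0;4;5;5;6;6;7;7;3;3]; [:: 0;0;4;7;5;5;6;6;7;3];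
  [:: 0;4;6;7;7;6;5;5;4;3]; [:: 0;4;4;6;7;7;5;5;6;3]; [:: 0;5;7;7;6;6;5;4;4;3];
  [:: 0;5;7;6;4;7;6;4;5;3]; [:: 0;4;4;5;6;7;7;6;5;3]; [:: 0;4;4;7;7;6;5;5;6;3]].

Definition segment_refutation : seq token := [::
  B 6 0; B 0 6; B 4 1; B 1 7; U; U; U; F 5 7; U; U; U; F 4 7; F 5 7; F 6 7; U;
  F 6 2; B 4 2; U; U; U; F 2 5; B 4 3; U; U; U; F 3 5; B 7 4; B 1 4; U; U; U;
  F 7 5; U; U; U; F 1 5; U; U; U; F 7 1; F 7 5; F 7 6; U; F 1 6; B 1 7; B 0 5;
  U; U; U; F 5 5; B 0 4; U; U; U; F 6 4; U; U; U; F 4 4; U; B 0 5; B 1 4;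
  B 5 6; B 2 6; U; U; U; F 0 1; B 4 2; U; U; U; F 3 6; F 4 6; U; B 7 1; U; U;
  U; F 1 5; F 7 5; U; U; U; U; F 7 2; F 7 4; F 7 5; U; U; U; U; F 0 1; F 1 5;
  F 4 7; F 6 7; U; F 2 4; U; F 0 2; B 7 1; U; F 7 5; U; F 7 2; F 7 4; U; U; U;
  U; F 4 6; F 5 6; U; F 0 1; U; F 2 4; U; F 5 2; B 1 6; B 0 4; U; U; U; F 1 4;
  F 4 7; F 6 7; U; F 6 1; U; U; U; F 4 7; F 5 7; F 6 7; U; F 5 1; B 0 4; B 5 7;
  B 5 1; U; U; U; F 2 5; F 5 5; U; B 5 2; U; U; U; F 4 5; F 5 5; F 5 6; U;
  F 1 4; F 3 4; U; B 5 3; U; U; F 0 2; U; F 4 5; F 5 6; U; F 4 6; B 7 0; U; U;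
  U; F 4 1; F 4 3; U; F 0 1; F 0 2; F 5 5; F 5 6; U; F 3 6; B 2 7; U; U; F 1 2;
  B 4 2; U; U; U; F 0 2; F 1 2; F 4 5; F 5 6; U; F 1 4; F 3 4; U; B 7 1; B 1 4;
  U; U; U; F 7 2; F 7 3; U; F 3 5; F 7 5; U; U; U; U; F 0 1; F 0 2; F 4 5;
  F 4 6; F 4 7; F 5 5; F 6 7; U; F 2 4; F 7 2; F 7 4; U; U; U; U; F 7 2; F 7 3;
  F 7 4; U; F 3 0; U; U; U; F 4 5; F 6 5; U; F 0 1; F 4 6; F 6 6; U; F 1 4;
  F 2 4; U; F 0 2; U; F 3 4; B 7 1; U; F 7 2; F 7 2; F 7 4; U; B 1 5; U; U; U;
  F 4 6; F 4 7; F 5 6; F 6 7; B 0 2; U; F 4 3; U; F 4 2; U; F 3 4; B 1 4;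
  B 6 7; B 2 7; U; U; U; F 4 1; F 4 5; U; B 4 1; U; U; U; F 4 5; F 4 6; F 5 5;
  F 5 6; U; F 0 2; F 4 7; U; F 3 7; U; U; F 4 5; F 4 6; F 4 7; U; F 5 5; F 5 6;
  F 5 7; F 6 5; F 6 6; B 7 6; U; F 1 3; F 7 5; B 0 1; U; F 3 4; U; F 5 2; U;
  F 3 4; U; F 5 2; F 7 1; U; F 0 1; F 2 5; U; U; U; U; F 4 6; F 5 6; U; F 6 1;
  B 2 6; B 5 1; U; U; U; F 4 4; B 5 4; U; U; U; F 6 4; F 6 5; F 6 6; U; F 3 6;
  U; F 6 6; U; F 1 2; B 3 6; B 6 6; U; F 1 3; F 6 4; F 6 5; U; U; F 4 4; U; U;
  F 6 4; F 6 5; B 0 1; U; U; F 0 2; U; F 6 1; U; U; F 4 4; U; F 2 4; F 3 4;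
  F 3 5; B 4 4; U; U; F 1 3; F 4 5; U; F 0 2; U; B 0 6; B 5 0; B 1 4; B 6 1; U;
  U; U; F 7 1; F 7 5; F 7 6; U; F 6 5; U; U; U; F 7 4; F 7 5; U; B 2 4; B 6 2;
  U; U; U; F 6 6; F 7 2; F 7 5; U; F 2 5; U; U; U; F 6 4; F 6 5; F 6 6; U;
  F 3 6; B 1 7; U; U; U; F 5 7; U; U; U; F 2 7; F 4 7; F 5 7; U; F 5 2; B 4 0;
  B 1 5; B 6 1; U; U; U; F 7 1; F 7 6; U; F 2 4; F 5 6; U; F 7 2; B 6 4; U; U;
  U; F 5 4; U; F 7 4; F 7 5; U; U; U; U; F 5 5; U; F 7 5; F 7 6; U; B 6 4;
  B 6 1; U; U; U; F 5 5; F 7 5; F 7 6; U; B 6 2; U; U; U; F 5 5; F 5 6; F 6 5;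
  F 6 6; U; F 1 3; U; B 2 5; U; U; U; F 5 4; F 5 5; F 6 5; F 6 6; U; F 3 0;
  B 1 7; U; U; U; F 2 0; F 5 4; F 5 5; U; F 4 1; F 4 2; U; F 3 4; U; F 4 3;
  B 4 1; B 3 4; U; U; U; F 1 2; F 5 4; F 5 6; F 5 7; F 6 5; F 6 6; F 6 7;
  F 7 5; F 7 6; F 7 7; U; F 3 6; U; U; U; F 3 7; B 1 2; U; F 3 5; F 3 6; U; U;
  F 6 5; F 5 5; F 5 7; U; F 1 3; U; U; F 1 2; U; F 5 4; F 5 6; F 5 7; F 6 5;
  F 6 6; F 6 7; F 7 5; F 7 6; F 7 7; U; F 3 6; U; U; U; F 5 5; F 5 6; F 7 5;
  F 7 6; B 3 5; U; F 4 3; U; F 3 0; U; F 4 1; F 4 2; B 1 7; U; F 5 7; U; F 3 7;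
  F 4 7; U; B 5 1; B 1 5; B 6 1; B 7 6; B 4 7; U; U; U; F 5 7; F 6 7; U; F 6 2;
  U; U; U; F 5 7; F 6 7; F 7 7; U; U; U; U; F 4 6; F 5 6; F 6 6; U; F 2 4;
  F 7 2; F 7 4; U; U; U; U; F 7 4; F 7 5; U; B 2 0; U; U; U; F 6 6; F 7 6;
  B 7 7; U; F 7 4; F 7 5; B 1 2; U; F 2 6; U; F 6 2; F 7 2; U; F 2 6; F 1 7; U;
  F 1 4; F 6 4; F 7 4; U; B 2 6; B 1 4; U; U; F 7 4; F 7 5; U; U; U; F 6 4; U;
  F 6 5; F 6 6; U; F 3 6; B 4 2; B 4 4; U; F 3 5; U; B 2 4; U; F 4 5; F 5 5; U;
  U; F 5 5; F 7 5; U; F 7 6; U; F 4 5; F 5 5; U; F 5 6; B 1 5; B 6 2; B 2 0; U;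
  U; U; F 4 4; F 4 5; U; B 3 0; U; U; U; F 2 5; F 4 4; F 4 5; U; B 5 4; U; U;
  U; F 7 4; F 7 5; U; B 2 4; B 2 5; U; U; F 3 4; F 4 4; U; U; F 5 5; F 6 5;
  F 7 5; U; F 3 1; U; U; F 3 5; F 6 5; F 7 5; U; B 4 4; B 4 3; U; U; U; F 6 4;
  F 7 4; U; F 3 5; F 4 2; F 4 5; U; U; U; U; F 5 3; B 4 2; U; F 2 0; U; U;
  F 6 4; F 7 4; U; U; F 4 2; F 4 5; F 4 6; U; F 3 6; B 4 6; B 2 6; B 4 3; U;
  F 1 2; F 5 5; F 7 5; U; U; F 5 4; U; F 5 3; B 2 0; B 4 2; U; F 4 5; F 5 5;
  F 6 5; F 7 5; U; F 5 6; F 6 6; U; F 6 3; B 1 7; U; F 6 7; F 4 7; F 6 7; U;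
  B 5 2; U; U; F 5 6; U; F 3 1; B 6 3; B 4 1; U; U; F 1 2; F 6 6; U; B 4 7;
  B 3 1; B 5 4; B 5 6; B 6 5; B 4 5; B 7 7; B 7 6; B 4 4; U; U; U; F 5 5; U; U;
  F 5 5; F 6 4; F 6 7; U; U; U; F 4 4; F 6 6; F 6 7; U; F 7 5; U; U; U; F 6 4;
  F 6 7; F 7 5; F 7 6; U; U; U; U; F 4 4; F 5 5; F 5 7; F 7 6; F 7 7; U; U;
  F 4 5; F 5 5; U; U; F 6 4; F 6 7; F 7 6; F 7 7; U; U; U; F 4 4; U; F 5 5;
  F 5 7; F 6 5; F 7 6; F 7 7; U; U; F 4 4; F 6 4; U; U; F 4 5; F 5 5; F 5 6;
  F 6 7; F 7 6; F 7 7; U; U; U; U; F 4 5; F 5 5; F 5 6; F 5 7; F 6 5; F 6 7;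
  F 7 6; F 7 7; U; F 4 4; U; F 5 7; F 6 7; F 7 7; U; F 3 1; U; F 5 5; F 6 5;
  F 7 6; U; F 3 4; F 5 4; U; U; F 7 3; U; F 5 5; F 6 5; B 5 2; U; F 1 3; F 5 6;
  F 6 6; U; F 1 2; U; F 5 6; F 6 6; F 7 6; B 6 3; U; F 4 5; B 1 7; U; F 6 7;
  F 4 7; F 5 7; F 6 7; F 7 7; U; U; F 4 4; F 1 3; U; F 4 2; U; F 5 5; F 6 5;
  F 7 5; B 5 2; U; F 1 3; F 5 6; F 6 6; U; F 1 2; U; F 5 6; F 6 6; F 7 6;
  B 6 4; U; F 5 4; F 7 4; B 1 7; U; F 2 7; F 4 2; F 4 7; U; F 5 7; F 6 7;
  F 7 7; U; F 2 0; F 3 1; F 4 4; U; F 5 3; F 1 4; F 4 4; U; F 7 4; B 4 0;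
  B 4 4; B 4 2; U; F 2 6; B 7 1; U; U; F 7 5; F 7 6; F 7 7; U; F 4 5; B 6 1; U;
  F 0 1; U; F 6 5; F 6 7; U; F 4 5; B 2 4; U; F 6 4; F 6 5; F 6 6; F 7 4;
  F 7 5; U; F 1 2; B 5 0; U; F 5 4; F 5 1; F 5 4; U; B 3 4; U; F 1 3; U; F 3 5;
  B 4 5; B 7 1; U; F 6 6; F 6 7; U; F 1 4; F 6 4; U; B 2 5; U; F 6 5; F 6 6; U;
  F 0 4; F 1 4; F 3 4; B 5 0; U; F 5 1; U; F 5 3; F 5 4; U; B 3 5; U; F 1 3;
  B 3 4; B 4 2; U; F 0 4; F 2 4; U; B 4 3; U; F 1 4; F 2 4; F 4 7; U; F 6 2;
  F 6 5; F 6 7; F 7 5; F 7 7; U; F 7 2; B 5 0; U; F 5 2; U; F 5 3; F 5 4; U;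
  B 2 4; B 5 4; U; F 6 3; F 6 4; U; B 5 5; U; F 6 3; U; F 5 2; U; F 5 6; F 7 3;
  F 7 6; U; U; F 0 2; F 0 4; F 1 4; F 4 6; U; F 6 5; F 7 6; U; F 5 1; F 5 3; U;
  U; F 0 2; F 0 4; F 1 4; F 4 6; F 4 7; U; F 6 6; F 6 7; F 7 6; B 5 0; U;
  F 5 1; U; F 5 2; F 5 4; U; U; F 0 4; F 1 4; F 2 4; F 4 6; F 4 7; U; F 0 2;
  F 6 6; F 6 7; F 7 6; U; F 3 0; B 5 0; U; F 5 1; F 5 2; F 5 4; U; B 1 7;
  B 7 1; U; U; F 0 4; F 6 4; F 6 5; U; F 2 0; B 2 6; U; U; F 6 6; U; F 7 6;
  B 5 0; U; F 6 5; F 7 4; U; F 5 4; F 5 5; F 5 6; F 5 7; U; F 6 5; U; B 4 1;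
  B 0 5; U; U; F 2 4; B 5 4; U; F 6 2; F 5 6; F 5 7; U; F 7 2; F 7 4; U; B 6 6;
  B 6 2; U; U; U; F 2 4; F 6 4; U; B 4 2; U; U; U; F 0 4; F 2 4; U; U; U; U;
  F 2 0; B 5 0; U; F 2 4; F 5 1; F 5 4; U; F 5 4; F 5 5; F 5 7; B 3 0; U;
  F 4 3; U; F 3 7; U; F 3 4; U; F 4 3; U; U; U; F 2 0; F 6 4; F 7 4; F 7 5;
  F 7 7; U; U; F 4 2; U; F 3 5; U; F 2 0; F 6 6; U; F 6 7; F 0 2; F 7 6; B 5 0;
  U; F 0 4; F 2 4; F 4 2; U; F 5 4; F 5 5; F 5 6; F 5 7; U; U; U; F 4 2; U;
  F 3 5; B 0 4; B 2 4; B 5 4; U; F 5 5; F 6 4; F 6 5; F 7 4; F 7 5; U; F 4 3;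
  F 6 6; U; F 3 6; B 6 4; U; F 5 0; F 5 1; U; F 4 6; F 5 6; U; B 7 7; B 7 6;
  B 7 1; U; F 2 0; F 6 6; F 6 7; B 0 5; U; F 1 5; F 5 2; F 5 6; U; F 5 0;
  F 1 2; F 5 5; F 5 6; F 5 7; F 6 5; U; F 3 4; U; F 4 3; B 4 1; B 0 5; U;
  F 5 6; F 7 2; U; F 2 5; F 5 2; F 5 5; U; U; F 5 2; U; F 5 5; F 5 6; U; F 3 5;
  U; F 5 2; F 5 5; U; F 3 4; F 6 5; U; F 6 3; U; F 0 2; F 1 4; F 4 7; F 5 7; U;
  F 3 5; F 5 5; F 6 5; F 7 2; U; F 6 3; U; F 0 2; F 0 5; F 1 5; F 4 6; F 5 6;
  U; U; F 7 3; F 7 5; U; F 3 5; B 7 1; B 1 5; B 2 6; U; U; F 1 4; F 2 7; U;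
  F 6 7; U; F 6 6; U; F 6 7; F 0 5; F 6 4; U; U; F 2 6; U; F 6 4; U; F 2 0;
  B 4 1; B 2 6; U; F 2 5; U; F 2 7; B 6 6; B 1 2; U; F 4 2; F 7 5; F 7 6; U;
  F 3 6; U; F 6 4; F 6 5; F 7 5; F 7 6; U; F 3 5; U; F 6 5; F 7 4; F 7 5; U;
  F 1 2; U; F 1 5; F 2 5; U; B 6 7; B 6 1; U; F 6 4; U; F 2 0; B 6 2; U; F 3 0;
  F 6 6; U; F 0 5; F 1 5; F 2 5; U; U; F 2 0; B 5 4; U; F 6 4; F 6 5; F 7 4; U;
  F 1 2; F 2 6; F 7 6; U; F 5 0; F 5 2; U; F 6 5; F 7 5; B 0 5; U; F 7 4; U;
  F 2 7; F 4 7; U; F 2 6; F 2 7; F 6 6; U; F 1 5; U; F 2 7; F 4 6; U; F 0 1; U;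
  B 1 6; B 6 5; B 6 4; B 3 5; U; U; F 0 1; B 5 0; U; F 5 3; U; F 5 3; F 5 4; U;
  U; U; F 3 7; F 4 7; U; F 0 2; U; U; F 4 1; U; F 2 0; U; F 4 2; U; F 3 7;
  F 4 7; U; U; F 7 4; F 7 6; U; U; F 2 0; F 4 1; U; F 4 2; U; F 3 7; F 4 7; U;
  B 2 6; B 6 1; U; F 6 5; U; B 4 1; B 6 2; U; F 6 4; F 6 5; U; F 3 4; B 2 5;
  B 3 5; U; F 7 5; F 7 6; U; U; F 3 6; U; F 2 4; U; U; F 6 4; F 6 5; F 6 6;
  F 7 5; F 7 6; U; F 3 6; U; F 1 4; F 1 5; F 2 4; F 2 5; B 6 1; U; F 4 7;
  F 6 7; U; U; F 6 4; F 6 5; U; B 5 1; B 1 7; B 5 5; U; U; U; F 4 5; U; F 2 6;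
  F 6 2; F 6 6; U; U; U; F 6 5; B 0 5; U; F 4 5; U; F 2 0; F 6 6; U; U; F 2 7;
  B 5 6; B 3 6; U; F 2 3; B 4 2; B 1 4; U; F 0 4; F 2 4; U; F 3 0; U; F 5 4; U;
  F 2 0; U; F 1 5; B 6 2; U; F 2 0; F 3 0; F 4 7; B 0 4; U; F 6 4; U; F 4 4;
  F 4 5; U; F 2 5; B 5 7; B 7 7; B 3 0; B 2 0; B 4 4; U; U; F 1 5; B 0 4;
  B 2 4; U; U; F 6 4; F 7 4; U; F 7 1; U; F 1 2; F 4 6; F 6 6; U; F 5 3; U;
  F 1 2; F 5 5; F 6 6; U; F 1 4; F 3 4; F 4 6; U; F 6 3; U; F 1 2; F 4 6;
  F 6 6; B 4 5; B 1 4; U; F 5 4; U; F 2 4; F 4 4; U; F 1 5; U; F 5 5; U; F 1 2;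
  F 4 6; F 6 6; B 1 4; U; F 5 4; F 4 4; U; F 2 0; U; F 1 5; U; F 1 2; F 4 6;
  F 6 6; B 1 4; U; F 2 4; F 7 2; F 7 4; U; F 4 4; U; F 2 0; U; F 1 5; U; F 1 2;
  F 2 0; F 4 6; F 6 6; F 7 6; B 0 4; U; F 5 4; F 4 4; U; F 4 5; F 2 5; B 1 4;
  U; U; F 6 7; F 7 7; B 4 7; U; F 1 2; F 2 4; U; F 3 4; U; F 6 3; F 6 4; U;
  F 6 4; F 6 6; F 7 4; F 7 6; U; F 2 4; U; F 3 4; F 4 3; U; U; F 4 4; F 6 4; U;
  F 1 2; F 2 0; U; F 2 6; B 4 6; B 2 6; B 6 3; U; U; U; F 5 6; F 6 7; F 7 6;
  B 3 4; U; F 4 4; F 7 4; U; F 1 2; U; U; F 7 3; B 1 6; B 3 6; U; F 6 2; B 7 7;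
  B 6 7; B 4 7; B 3 7; U; F 6 2; B 5 7; B 4 2; U; F 3 1; F 6 6; F 7 6; B 0 4;
  U; F 6 4; U; F 4 5; U; B 6 3; U; U; U; F 0 2; F 6 6; F 7 6; B 0 4; U; F 6 4;
  F 7 4; U; U; F 7 3; U; F 2 0; F 3 0; F 6 6; F 7 6; U; F 6 3; U; F 2 0; F 3 0;
  F 5 6; F 6 6; F 7 6; U; F 4 3; U; F 2 0; F 3 0; F 5 6; F 7 6; U; F 4 3; U;
  F 2 0; F 3 0; F 5 6; F 6 6; U; F 4 3; B 2 0; B 3 6; B 1 2; U; F 6 2; U;
  F 5 6; F 6 6; U; F 6 3; B 3 1; B 3 0; B 5 6; B 7 6; B 7 2; B 0 4; U; U;
  F 4 1; U; F 4 4; B 1 4; U; U; F 4 1; U; F 4 4; U; F 2 4; F 2 5; U; F 5 5; U;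
  B 6 6; B 5 2; U; F 4 2; B 4 4; U; F 1 5; F 5 4; U; F 1 5; B 6 3; B 3 4; U; U;
  F 4 2; F 4 4; U; B 6 5; U; F 1 4; F 2 4; U; F 4 1; F 4 4; U; U; F 4 5; B 0 5;
  U; U; F 1 4; F 7 4; F 7 5; U; F 1 2; F 4 7; F 5 4; F 5 7; U; F 3 5; U; U;
  F 4 1; F 4 3; B 4 4; U; F 1 5; F 5 4; F 7 4; U; F 0 2; B 0 5; U; F 4 5; U;
  F 1 5; F 4 5; U; U; F 0 2; F 1 2; F 4 7; F 5 7; F 7 7; B 7 3; B 4 5; B 1 4;
  U; F 4 4; U; U; U; U; U; F 3 4; F 5 4; U; F 3 5; U; U; U; F 5 5; B 4 3;
  B 7 4; U; F 4 4; B 0 5; U; F 2 5; U; F 3 5; F 4 5; F 5 5; U; F 3 4; U; F 4 4;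
  F 5 2; F 6 2; B 0 4; U; F 5 4; F 4 4; U; F 4 5; U; F 2 5; U; F 4 7; F 5 7;
  F 6 7; B 5 2; B 0 4; U; F 4 4; U; F 4 4; U; F 4 5; U; F 2 5; F 0 2; F 1 2;
  B 4 3; B 5 4; U; F 4 4; B 0 5; U; F 2 5; U; F 3 5; F 4 5; F 5 5; F 6 5; U;
  F 3 4; U; F 4 4; U; F 5 3; F 6 3; U; U; F 4 7; F 6 7; F 7 7; B 6 2; B 0 4; U;
  U; U; F 5 4; F 4 4; U; F 4 5; U; U; F 2 5; F 0 2; F 1 2; B 4 5; B 4 3; B 1 4;
  U; F 7 4; U; F 3 4; F 4 4; U; U; F 5 3; F 6 3; U; F 6 6; U; F 0 5; F 1 5;
  F 2 5; F 3 5; U; F 5 5; F 6 5; F 7 5; U; F 4 1; F 4 4; U; U; F 5 6; F 5 7;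
  F 6 6; F 6 7; F 7 6; F 7 7; B 7 3; U; F 1 2; U; F 4 7; B 6 5; U; F 4 5;
  F 5 5; B 0 4; U; F 4 4; F 3 4; U; F 5 4; U; F 3 5; F 5 5; U; B 6 2; B 0 4; U;
  U; F 1 4; F 4 1; F 4 4; U; U; F 5 5; F 6 4; U; F 3 5; U; F 4 3; B 2 4; U;
  F 7 4; F 4 4; B 0 5; U; F 2 5; U; F 3 5; F 4 5; F 5 5; U; U; F 4 7; F 5 6;
  F 5 7; F 6 6; F 6 7; F 7 6; F 7 7; B 5 2; U; F 1 3; B 3 5; U; F 5 5; F 4 5;
  F 6 5; B 1 4; U; F 5 4; U; F 3 4; F 4 4; U; F 1 2; B 5 5; B 3 5; U; F 4 1;
  F 4 2; U; F 2 5; U; F 4 5; F 6 5; F 7 5; B 0 4; B 4 3; U; F 3 4; F 4 4; U;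
  F 5 3; F 6 3; U; U; F 2 4; F 4 4; F 7 4; U; F 6 3; F 1 5; U; F 3 5; F 4 5; U;
  F 5 3; U; F 5 6; F 6 6; F 6 7; F 7 6; F 7 7; B 3 6; U; F 6 3; F 3 1; B 7 3;
  U; F 0 2; F 1 2; U; F 4 7; B 4 4; U; U; F 7 4; B 0 5; U; F 2 5; U; F 3 5;
  F 5 5; U; F 3 4; F 5 4; U; B 6 2; B 1 4; U; U; F 4 1; F 4 4; U; F 5 4; F 6 4;
  U; F 3 0; U; F 1 5; F 0 2; U; F 4 3; B 4 4; U; F 4 7; F 7 4; B 0 5; U; F 2 5;
  U; F 3 5; F 4 5; F 5 5; U; F 1 4; F 3 4; F 5 4; F 6 4; U; U; F 5 7; F 6 7;
  F 7 7; B 5 2; U; F 3 1; F 5 6; B 2 4; U; F 3 4; F 4 4; U; F 5 4; U; F 3 0; U;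
  F 1 5; F 0 2; U; F 5 6; F 6 6; F 7 6; B 6 3; U; F 3 1; B 5 4; U; F 3 0;
  B 0 5; U; F 2 5; U; F 3 5; F 5 5; U; F 3 4; F 4 4; U; F 6 4; U; F 4 1; F 4 2;
  F 4 3; B 6 4; B 1 6; U; U; U; F 6 5; F 7 4; U; F 3 5; F 1 2; B 4 5; U; F 2 0;
  F 5 5; U; F 1 4; F 4 4; U; F 6 5; F 7 5; B 0 4; U; F 2 0; U; F 1 4; F 2 4;
  F 7 4; U; F 3 5; B 2 4; U; F 3 6; U; F 2 5; F 2 7; U; F 0 4; F 4 4; U; F 2 0].

(** With 2 + 2 vertices on the cycle and 5 + 5 outside, this check takes place in K_(7,7); the next
    two take place in K_(8,8). *)
Lemma C4_to_C6_certified : certified 2 5 true C4_to_C6_paths C4_to_C6_refutation.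
Proof. by vm_cast_no_check (erefl true). Qed.

Lemma C6_to_C8_certified : certified 3 5 true C6_to_C8_paths C6_to_C8_refutation.
Proof. by vm_cast_no_check (erefl true). Qed.

Lemma segment_certified : certified 4 4 false segment_paths segment_refutation.
Proof. by vm_cast_no_check (erefl true). Qed.

(** * The upper bound *)

Lemma C8_of_C4 b (c : edge_coloring (complete_bipartite b b)) k : 8 <= b ->
  ~ has_alt_cycle (coloured c (~~ k)) 4 ->
  has_alt_cycle (coloured c k) 2 -> has_alt_cycle (coloured c k) 4.
Proof.
move=> b_ge8 no_C8 C4.
(* This extension uses 3 + 5 vertices on each side, the whole of [8 <= b]; the one before it uses 2
   + 5. *)
apply: (longer_coloured_cycle C6_to_C8_certified) => //.
by apply: (longer_coloured_cycle C4_to_C6_certified) => //; lia.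
Qed.

(** Candidate cycles of a given length form a finite type, which makes the case distinctions below
    constructive. *)
Lemma alt_cycle_dec (X Y : finType) (e : X -> Y -> bool) k :
  has_alt_cycle e k \/ ~ has_alt_cycle e k.
Proof.
have [/existsP[t ct]|no] := boolP [exists t : k.-tuple (X * Y), alt_cycle e t].
  by left; exists t; rewrite ?size_tuple.
right=> -[q szq cq]; case/existsP: no.
by exists (Tuple (introT eqP szq)).
Qed.

Lemma bip_arrows_cycles n : 5 <= n ->
  bip_arrows (n + 3) (cycle_graph 8) (cycle_graph (2 * n)).
Proof.
move=> n_ge5 c.
have b_ge8 : 8 <= n + 3 by lia.
case: (alt_cycle_dec (coloured c true) 4) => [red|no_red].
  by left; apply: (@mono_copy_of_alt_cycle _ _ _ 4).
right; apply: mono_copy_of_alt_cycle; first by lia.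
have C8 : has_alt_cycle (coloured c false) 4.
  (* A blue C_4 grows to a blue C_8 because there is no red one. If the C_4 is red and there were no
     blue C_8, it would grow to a red C_8, which is excluded. *)
  have [||[] C4] := @mono_alt_cycle2 _ _ (fun i j => c [set inl i; inr j]);
    rewrite ?card_ord; try lia; last exact: C8_of_C4.
  case: (alt_cycle_dec (coloured c false) 4) => // no_blue.
  by case: no_red; apply: C8_of_C4.
(* Going from l to l + 1 pairs requires l + 4 vertices on each side, and l + 4 is at most n + 3
   exactly when l + 1 is at most n. *)
have grow i : 4 + i <= n -> has_alt_cycle (coloured c false) (4 + i).
  elim: i => [//|i IH]; rewrite addnS => i_lt.
  apply: (longer_coloured_cycle segment_certified) => //; try lia.
  by apply: IH; lia.
have n_ge4 : 4 <= n by lia.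
by have := grow (n - 4); rewrite subnKC //; apply.
Qed.

Theorem theorem7 (n : nat) (hn : 5 <= n) :
  is_BR (cycle_graph 8) (cycle_graph (2 * n)) (n + 3).
Proof.
split; [by lia | exact: bip_arrows_cycles |].
move=> b _ arr; rewrite leqNgt; apply/negP => lt_b.
by apply: (@not_bip_arrows n b) arr; lia.
Qed.
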